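(* The linear system $\mathcal{L}(174;55^{10})$ of plane curves of degree $174$ having multiplicity at least $55$ at each of ten general points of $\mathbb{P}^2$ is empty.
   Context: We work over the complex numbers. $\mathcal{L}(d;m^{10})$ denotes the linear system of curves of degree $d$ in $\mathbb{P}^2$ having multiplicity at least $m$ at each of ten general points $p_1,\dots,p_{10}$ (general: the tuple lies in a suitable dense open subset of $(\mathbb{P}^2)^{10}$). *)

(* Defs.v *)
From HB Require Import structures.
From mathcomp Require Import all_boot all_order all_algebra.
From mathcomp Require Import classical_sets reals complex.
From mathcomp Require Import mpoly.

Set Implicit Arguments.
Unset Strict Implicit.
Unset Printing Implicit Defensive.

Import Order.TTheory GRing.Theory Num.Theory.

Local Open Scope classical_set_scope.
Local Open Scope ring_scope.

(* P(V): a point is a one-dimensional subspace (a line through 0) of V. *)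
Definition projspace (K : fieldType) (V : vectType K) : Type :=
  {L : {vspace V} | \dim L == 1%N}.

Definition P2 (K : fieldType) : Type := projspace 'rV[K]_3.

(* A plane curve of degree d (possibly reducible or non-reduced) is a nonzero
   form of degree d up to scaling, so |O(d)| is the projective space of forms. *)
Definition curve (K : fieldType) (d : nat) : Type :=
  projspace (dhomog 3 K d).

(* The forms of multidegree e on (P^2)^n. The homogeneous coordinates of the
   i-th factor are the three variables of index mxvec_index i j, j < 3. *)
Definition multihomog (K : fieldType) (n : nat) (e : 'I_n -> nat)
    (G : {mpoly K[n * 3]}) : Prop :=
  forall mo : 'X_{1..n * 3}, mo \in msupp G ->
  forall i : 'I_n, (\sum_(j < 3) mo (mxvec_index i j))%N = e i.

(* The i-th row of M is a vector of homogeneous coordinates of p i;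
   such a row is nonzero, since the line p i has dimension 1. *)
Definition homog_coords (K : fieldType) (n : nat) (p : 'I_n -> P2 K)
    (M : 'M[K]_(n, 3)) : Prop :=
  forall i : 'I_n, <[row i M]>%VS = sval (p i).

(* Zariski topology of the product variety (P^2)^n: the closed sets are the
   common zero loci of families of multihomogeneous polynomials. *)
Definition zariski_closed (K : fieldType) (n : nat)
    (Z : set ('I_n -> P2 K)) : Prop :=
  exists S : set {mpoly K[n * 3]},
    (forall G, S G -> exists e : 'I_n -> nat, multihomog e G) /\
    Z = [set p | forall G M, S G -> homog_coords p M -> G.@[mxvec M 0] = 0].

Definition zariski_open (K : fieldType) (n : nat)
    (U : set ('I_n -> P2 K)) : Prop :=
  zariski_closed (~` U).

Definition zariski_dense (K : fieldType) (n : nat)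
    (U : set ('I_n -> P2 K)) : Prop :=
  forall V : set ('I_n -> P2 K), zariski_open V -> V !=set0 -> U `&` V !=set0.

Definition for_general_points (K : fieldType) (n : nat)
    (P : ('I_n -> P2 K) -> Prop) : Prop :=
  exists U : set ('I_n -> P2 K),
    [/\ zariski_open U, zariski_dense U & forall p, U p -> P p].

(* Equation of the curve F = 0 in the affine chart x_i = 1, in the two affine
   coordinates translated so that the point [v], with v_i = 1, is the origin. *)
Definition local_equation (K : fieldType) (F : {mpoly K[3]}) (i : 'I_3)
    (v : 'rV[K]_3) : {mpoly K[2]} :=
  F \mPo [tuple (if unlift i k is Some j then 'X_j + (v 0 k)%:MP else 1)
         | k < 3].

(* A local equation of C at x has no term of degree less than m. The order of a
   local equation depends neither on the chart containing x nor on the form F,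
   so "some" and "every" local equation give the same notion. *)
Definition mult_at_least (K : fieldType) (d m : nat) (C : curve K d)
    (x : P2 K) : Prop :=
  exists (F : dhomog 3 K d) (v : 'rV[K]_3) (i : 'I_3),
    [/\ <[F]>%VS = sval C, <[v]>%VS = sval x, v 0 i = 1
      & forall mo : 'X_{1..2}, (mdeg mo < m)%N ->
          (local_equation F i v)@_mo = 0].

(* L(d; m_1, ..., m_n), based at the points p_1, ..., p_n. *)
Definition linear_system (K : fieldType) (n d : nat) (m : 'I_n -> nat)
    (p : 'I_n -> P2 K) : set (curve K d) :=
  [set C | forall i : 'I_n, mult_at_least (m i) C (p i)].
Arguments linear_system {K n} d%_N m p _.

(* Main.v *)
(* Specialise the ten points to P_l = (7 l, g (7 l)), l < 10, on the curve
   y = g x, g = x^3 + x^8, and reduce modulo 7, where they all collapse to the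
   origin. Let f in Z[x, y] have degree at most 174 and multiplicity at least
   55 at each P_l, and write f (x, g x + z) = \sum_b f_b z^b. Then the monic
   polynomial \prod_l (x - 7 l)^(55 - b) divides f_b, so x^(550 - 10 b) divides
   f_b mod 7: these are 15400 linear equations over F_7 in the 15400
   coefficients c_ij of f mod 7.

   Give x^i y^j the weight W = i + 3 j. As g = x^3 (1 + x^5), the equations only
   relate weights congruent mod 5, and they are triangular in W: with
     a_(W, n) = \sum_j c_(W - 3 j, j) 'C(j, n)
   they read \sum_e 'C(b + e, e) a_(W - 5 e, b + e) = 0 for W + 7 b < 550.
   Solving them weight by weight leaves about 80 free parameters in each of the
   five classes mod 5, and as many equations between those, of full rank by
   computation. Hence 7 divides f, and f = 0 by infinite descent.

   So some maximal minor of the matrix of conditions is nonzero at (P_l). It is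
   a multihomogeneous polynomial in the coordinates of the points, and the
   system is empty wherever it does not vanish. *)

Require Import Defs.
From HB Require Import structures.
From mathcomp Require Import all_boot all_order all_algebra perm.
From mathcomp Require Import zify ring.
From mathcomp Require Import boolp classical_sets reals complex.
From mathcomp Require Import mpoly.

Set Implicit Arguments.
Unset Strict Implicit.
Unset Printing Implicit Defensive.

Import Order.TTheory GRing.Theory Num.Theory.

Local Open Scope classical_set_scope.
Local Open Scope ring_scope.

(** * Solving the equations modulo 7 *)

(* F_7 as an enumerated type: sums and products are computed by case analysis,
   much faster than with the unary numbers that underlie ['F_7]. *)
Inductive d7 := D0 | D1 | D2 | D3 | D4 | D5 | D6.

Definition nat7 (x : d7) : nat :=
  match x with D0 => 0 | D1 => 1 | D2 => 2 | D3 => 3 | D4 => 4 | D5 => 5 | D6 => 6 end.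

Definition succ7 (x : d7) : d7 :=
  match x with D0 => D1 | D1 => D2 | D2 => D3 | D3 => D4 | D4 => D5 | D5 => D6 | D6 => D0 end.

Definition opp7 (x : d7) : d7 :=
  match x with D0 => D0 | D1 => D6 | D2 => D5 | D3 => D4 | D4 => D3 | D5 => D2 | D6 => D1 end.

Definition inv7 (x : d7) : d7 :=
  match x with D0 => D0 | D1 => D1 | D2 => D4 | D3 => D5 | D4 => D2 | D5 => D3 | D6 => D6 end.

Definition add7 (x y : d7) : d7 :=
  match x with
  | D0 => y
  | D1 => succ7 y
  | D2 => succ7 (succ7 y)
  | D3 => succ7 (succ7 (succ7 y))
  | D4 => succ7 (succ7 (succ7 (succ7 y)))
  | D5 => succ7 (succ7 (succ7 (succ7 (succ7 y))))
  | D6 => succ7 (succ7 (succ7 (succ7 (succ7 (succ7 y)))))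
  end.

Definition mul7 (x y : d7) : d7 :=
  match x with
  | D0 => D0
  | D1 => y
  | D2 => add7 y y
  | D3 => add7 y (add7 y y)
  | D4 => opp7 (add7 y (add7 y y))
  | D5 => opp7 (add7 y y)
  | D6 => opp7 y
  end.

Definition F7 (x : d7) : 'F_7 := (nat7 x)%:R.

Lemma F7D x y : F7 (add7 x y) = F7 x + F7 y.
Proof. by apply/val_inj; case: x; case: y. Qed.

Lemma F7M x y : F7 (mul7 x y) = F7 x * F7 y.
Proof. by apply/val_inj; case: x; case: y. Qed.

Lemma F7N x : F7 (opp7 x) = - F7 x.
Proof. by apply/val_inj; case: x. Qed.

Lemma F7V x : F7 x != 0 -> F7 x * F7 (inv7 x) = 1.
Proof. by move=> nz; apply/val_inj; case: x nz. Qed.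

(* A linear form in the parameters, by its coefficients. Missing trailing
   coefficients are 0, so [::] is the zero form. *)
Definition form := seq d7.

Fixpoint axpy_rec (c : d7) (u v : form) : form :=
  match u, v with
  | [::], _ => v
  | _, [::] => map (mul7 c) u
  | x :: u', y :: v' => add7 (mul7 c x) y :: axpy_rec c u' v'
  end.

(** Many binomial coefficients vanish modulo 7, hence the shortcut for a zero scalar. *)
Definition axpy (c : d7) (u v : form) : form :=
  if c is D0 then v else axpy_rec c u v.

Arguments axpy : simpl never.

Definition var (k : nat) : form := rcons (nseq k D0) D1.

Fixpoint ev (env : seq 'F_7) (f : form) : 'F_7 :=
  match env, f with
  | e :: env', x :: f' => F7 x * e + ev env' f'
  | _, _ => 0
  end.

Lemma ev0 env : ev env [::] = 0.
Proof. by case: env. Qed.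

Lemma ev_zero n f : ev (nseq n 0) f = 0.
Proof. by elim: n f => [|n IHn] [|x f] //=; rewrite IHn mulr0 addr0. Qed.

Lemma ev_map env c u : ev env (map (mul7 c) u) = F7 c * ev env u.
Proof.
elim: env u => [|e env IHe] [|x u] //=; rewrite ?mulr0 //.
by rewrite IHe F7M mulrDr mulrA.
Qed.

Lemma ev_axpy env c u v : ev env (axpy c u v) = F7 c * ev env u + ev env v.
Proof.
have loopE : ev env (axpy_rec c u v) = F7 c * ev env u + ev env v.
  elim: env u v => [|e env IHe] [|x u] [|y v] //=; rewrite ?mulr0 ?add0r ?addr0 //.
    by rewrite ev_map F7M mulrDr mulrA.
  by rewrite IHe F7D F7M mulrDr mulrDl mulrA addrACA.
by rewrite /axpy; case: c loopE => //= _; rewrite mul0r add0r.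
Qed.

Lemma ev_var env k : ev env (var k) = env`_k.
Proof.
rewrite /var; elim: k env => [|k IHk] [|e env] //=.
  by case: env => [|? ?] /=; rewrite mul1r addr0.
by rewrite IHk mul0r add0r.
Qed.

Fixpoint dot_form (cs : seq d7) (fs : seq form) : form :=
  match cs, fs with
  | c :: cs', f :: fs' => axpy c f (dot_form cs' fs')
  | _, _ => [::]
  end.

Lemma ev_dot_form env cs fs :
  ev env (dot_form cs fs) =
  \sum_(k < size fs) F7 (nth D0 cs k) * ev env (nth [::] fs k).
Proof.
elim: fs cs => [|f fs IHf] [|c cs] /=; rewrite ?ev0 ?big_ord0 //.
  by rewrite big1 // => k _; rewrite nth_nil mul0r.
by rewrite ev_axpy big_ord_recl /= IHf.
Qed.

Fixpoint sub_row (r : seq d7) (h acc : seq form) : seq form :=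
  match r, h, acc with
  | c :: r', f :: h', a :: acc' => axpy (opp7 c) f a :: sub_row r' h' acc'
  | _, _, _ => acc
  end.

Lemma size_sub_row r h acc : size (sub_row r h acc) = size acc.
Proof. by elim: r h acc => [|c r IHr] [|f h] [|a acc] //=; rewrite IHr. Qed.

Lemma ev_sub_row env r h acc b : (b < size acc)%N -> (size acc <= size r)%N ->
  ev env (nth [::] (sub_row r h acc) b) =
  ev env (nth [::] acc b) - F7 (nth D0 r b) * ev env (nth [::] h b).
Proof.
elim: r h acc b => [|c r IHr] [|f h] [|a acc] [|b] //= lt_b le_acc;
  rewrite ?ev0 ?mulr0 ?subr0 //.
  by rewrite ev_axpy F7N mulNr addrC.
by rewrite IHr.
Qed.

(** Started at zero, with [Rs] holding the 'C(b + e, e) for e > 0, it yields the value that the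
    equation of order b forces on a_(W, b). *)
Fixpoint history_sum (Rs : seq (seq d7)) (H : seq (seq form)) (acc : seq form) :=
  match Rs, H with
  | r :: Rs', h :: H' => sub_row r h (history_sum Rs' H' acc)
  | _, _ => acc
  end.

Lemma size_history_sum Rs H acc : size (history_sum Rs H acc) = size acc.
Proof. by elim: Rs H => [|r Rs IHr] [|h H] //=; rewrite size_sub_row IHr. Qed.

Lemma ev_history_sum env Rs H acc b : (b < size acc)%N -> (size H <= size Rs)%N ->
  all (fun r => size acc <= size r)%N Rs ->
  ev env (nth [::] (history_sum Rs H acc) b) = ev env (nth [::] acc b) -
  \sum_(e < size H) F7 (nth D0 (nth [::] Rs e) b) * ev env (nth [::] (nth [::] H e) b).
Proof.
move=> lt_b; elim: H Rs => [|h H IHH] [|r Rs] //= le_H;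
  rewrite ?big_ord0 ?subr0 // => /andP[le_r le_acc].
by rewrite ev_sub_row ?size_history_sum // big_ord_recl /= IHH // opprD addrA [RHS]addrAC.
Qed.

(* One weight W. With j0 = min_exp d W, all j such that x^(W - 3 j) y^j has
   degree at most d are at least j0, so that
     a_(W, n) = \sum_k 'C(j0, k) q_(n - k),  q_n = 0 for n >= J,
   where q_n and J stand for [reduced_coef] and [num_exp]. Here [row] is
   'C(j0, k), k > 0; [t] gives the values prescribed for a_(W, n), n < B; [rq]
   lists the forms of q_(n - 1), ..., q_0; [np] is the number of parameters
   introduced so far. For n < J, q_n is solved for if n < B and becomes a new
   parameter otherwise; for J <= n < B we get an equation between parameters.
   The result consists of the forms of a_(W, n), these equations, and the new
   number of parameters. *)
Fixpoint level_step (fuel B J : nat) (row : seq d7) (t rq : seq form) (np : nat) :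
    seq form * seq form * nat :=
  if fuel is fuel'.+1 then
    let s := dot_form row rq in
    let t0 := head [::] t in
    match J, B with
    | J'.+1, B'.+1 =>
      let: (a, c, n) := level_step fuel' B' J' row (behead t) (axpy D6 s t0 :: rq) np in
      (t0 :: a, c, n)
    | J'.+1, 0 =>
      let v := var np in
      let: (a, c, n) := level_step fuel' 0 J' row (behead t) (v :: rq) np.+1 in
      (axpy D1 s v :: a, c, n)
    | 0, B'.+1 =>
      let: (a, c, n) := level_step fuel' B' 0 row (behead t) ([::] :: rq) np in
      (s :: a, axpy D6 t0 s :: c, n)
    | 0, 0 =>
      let: (a, c, n) := level_step fuel' 0 0 row (behead t) ([::] :: rq) np in
      (s :: a, c, n)
    end
  else ([::], [::], np).

(** The term k = 0 of the convolution has coefficient 1 and stands apart, so that it can be solved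
    for q n. *)
Definition conv_bin (row : seq d7) (q : nat -> 'F_7) (n : nat) : 'F_7 :=
  q n + \sum_(k < n) F7 (nth D0 row k) * q (n - k.+1)%N.

(** The actual solution [q] is fixed beforehand, and [env] lists its values at the parameters,
    including those yet to be introduced; every form built then evaluates to the true quantity. [n0]
    counts the steps already done. *)
Lemma level_step_sound env row q fuel B J t rq np n0 :
  (size rq = n0) ->
  (forall k, (k < n0)%N -> ev env (nth [::] rq k) = q (n0 - k.+1)%N) ->
  (forall i, (B <= i)%N -> (i < J)%N -> env`_(np + (i - B)) = q (n0 + i)%N) ->
  (forall i, (J <= i)%N -> q (n0 + i)%N = 0) ->
  (forall i, (i < B)%N -> (i < fuel)%N -> ev env (nth [::] t i) = conv_bin row q (n0 + i)) ->
  (J <= fuel)%N ->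
  let: (a, c, n) := level_step fuel B J row t rq np in
  [/\ size a = fuel,
      forall i, (i < fuel)%N -> ev env (nth [::] a i) = conv_bin row q (n0 + i)%N,
      all (fun f => ev env f == 0) c & n = (np + (J - B))%N].
Proof.
have F76 : F7 D6 = -1 by apply/val_inj.
elim: fuel B J t rq np n0 => [|fuel IHf] B J t rq np n0 sz_rq rqE envE q0 tE le_J /=.
  by move: le_J; rewrite leqn0 => /eqP ->; rewrite sub0n addn0.
have sE : ev env (dot_form row rq) = conv_bin row q n0 - q n0.
  rewrite ev_dot_form sz_rq /conv_bin addrC addKr; apply: eq_bigr => k _.
  by rewrite rqE.
(* The induction hypothesis in the form shared by the four cases: [f] is the form chosen for q
   n0. *)
have step f J' B' np' : (J' <= fuel)%N -> ev env f = q n0 ->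
    (forall i, (B' <= i)%N -> (i < J')%N -> env`_(np' + (i - B')) = q (n0.+1 + i)%N) ->
    (forall i, (J' <= i)%N -> q (n0.+1 + i)%N = 0) ->
    (forall i, (i < B')%N -> (i < fuel)%N ->
       ev env (nth [::] (behead t) i) = conv_bin row q (n0.+1 + i)) ->
    let: (a, c, n) := level_step fuel B' J' row (behead t) (f :: rq) np' in
    [/\ size a = fuel,
      forall i, (i < fuel)%N -> ev env (nth [::] a i) = conv_bin row q (n0.+1 + i)%N,
      all (fun f => ev env f == 0) c & n = (np' + (J' - B'))%N].
  move=> le_J' fE envE' q0' tE'; apply: IHf => //=; first by rewrite sz_rq.
  by case=> [_|k lt_k] /=; rewrite ?subn1 // rqE.
have t0E : (0 < B)%N -> ev env (head [::] t) = conv_bin row q n0.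
  by move=> B0; rewrite -nth0 tE // addn0.
have tE' B' i : (B' <= B.-1)%N -> (i < B')%N -> (i < fuel)%N ->
    ev env (nth [::] (behead t) i) = conv_bin row q (n0.+1 + i).
  by move=> le_B' lt_i lt_if; rewrite nth_behead tE ?addSnnS //; lia.
have q0S i : (J <= i.+1)%N -> q (n0.+1 + i)%N = 0 by move=> le_i; rewrite addSnnS q0.
have aE f a : ev env f = conv_bin row q n0 ->
    (forall i, (i < fuel)%N -> ev env (nth [::] a i) = conv_bin row q (n0.+1 + i)%N) ->
    forall i, (i < fuel.+1)%N -> ev env (nth [::] (f :: a) i) = conv_bin row q (n0 + i)%N.
  by move=> fE IHa [|i] lt_i; rewrite ?addn0 //= IHa // addSnnS.
case: J le_J envE q0 q0S => [|J] le_J envE q0 q0S; case: B envE tE t0E tE' => [|B] envE tE t0E tE'.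
- have qn0 : q n0 = 0 by rewrite -[n0]addn0 q0.
  have := step [::] 0%N 0%N np; case: (level_step _ _ _ _ _ _ _) => [[a c] n].
  case; rewrite ?ev0 //.
  move=> sz_a IHa c0 nE; split; rewrite //= ?sz_a //.
  by apply: aE => //; rewrite sE qn0 subr0.
(* As q n0 vanishes, the prescribed value must equal the sum over the earlier q: an equation between
   parameters. *)
- have qn0 : q n0 = 0 by rewrite -[n0]addn0 q0.
  have := step [::] 0%N B np; case: (level_step _ _ _ _ _ _ _) => [[a c] n].
  case; rewrite ?ev0 //.
    by move=> i; apply: tE' => /=.
  move=> sz_a IHa c0 nE; split; rewrite //= ?sz_a //.
    by apply: aE => //; rewrite sE qn0 subr0.
  by rewrite c0 ev_axpy F76 sE t0E // qn0 subr0 mulN1r addNr eqxx.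
- have qE : env`_np = q n0 by have := envE 0%N isT isT; rewrite !addn0.
  have := step (var np) J 0%N np.+1; case: (level_step _ _ _ _ _ _ _) => [[a c] n].
  case=> //; rewrite ?ev_var //.
    move=> i _ lt_i; rewrite !addSnnS -envE //; congr (_`_(_)); lia.
  move=> sz_a IHa c0 nE; split; rewrite //= ?sz_a //; last by rewrite nE; lia.
  apply: aE => //; rewrite ev_axpy ev_var sE qE mul1r; exact: subrK.
- have := step (axpy D6 (dot_form row rq) (head [::] t)) J B np.
  case: (level_step _ _ _ _ _ _ _) => [[a c] n].
  case=> //.
  + by rewrite ev_axpy F76 mulN1r sE t0E // opprB subrK.
  + move=> i le_i lt_i; rewrite !addSnnS -envE //; congr (_`_(_)); lia.
  + by move=> i; apply: tE' => /=.
  by move=> sz_a IHa c0 nE; split; rewrite //= ?sz_a //; apply: aE => //; exact: t0E.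
Qed.

Arguments level_step : simpl never.

(** * Tables of binomial coefficients modulo 7 *)

Fixpoint partial_sums (acc : d7) (l : seq d7) : seq d7 :=
  if l is x :: l' then let y := add7 acc x in y :: partial_sums y l' else [::].

Fixpoint bin_diagonals (n : nat) (r : seq d7) : seq (seq d7) :=
  if n is n'.+1 then let r' := partial_sums D0 r in r' :: bin_diagonals n' r' else [::].

Fixpoint pascal_next (x : d7) (r : seq d7) : seq d7 :=
  if r is y :: r' then add7 x y :: pascal_next y r' else [:: x].

Fixpoint pascal_rows (n : nat) (r : seq d7) : seq (seq d7) :=
  if n is n'.+1 then r :: pascal_rows n' (pascal_next D0 r) else [::].

Lemma size_partial_sums acc l : size (partial_sums acc l) = size l.
Proof. by elim: l acc => //= x l IHl acc; rewrite IHl. Qed.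

(** Hockey-stick identity: [acc] is the sum of the terms before index b0. *)
Lemma partial_sums_bin e b0 acc l :
  F7 acc = 'C(b0 + e, e.+1)%:R ->
  (forall i, (i < size l)%N -> F7 (nth D0 l i) = 'C(b0 + i + e, e)%:R) ->
  forall i, (i < size l)%N -> F7 (nth D0 (partial_sums acc l) i) = 'C(b0 + i + e.+1, e.+1)%:R.
Proof.
elim: l b0 acc => [|x l IHl] b0 acc accE lE [|i] //= lt_i.
  by rewrite F7D accE (lE 0%N) // addn0 addnS binS natrD.
rewrite (IHl b0.+1) ?addSnnS //.
  by rewrite F7D accE (lE 0%N) // addn0 addnS binS natrD.
by move=> k lt_k; rewrite (lE k.+1) // ?addSnnS.
Qed.

Lemma bin_diagonalsP N n e r : size r = N ->
  (forall i, (i < N)%N -> F7 (nth D0 r i) = 'C(i + e, e)%:R) ->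
  [/\ size (bin_diagonals n r) = n, all (fun s => size s == N) (bin_diagonals n r) &
    forall k i, (k < n)%N -> (i < N)%N ->
      F7 (nth D0 (nth [::] (bin_diagonals n r) k) i) = 'C(i + (e + k).+1, (e + k).+1)%:R].
Proof.
elim: n e r => [|n IHn] e r sz_r rE //=.
have r'E i : (i < N)%N -> F7 (nth D0 (partial_sums D0 r) i) = 'C(i + e.+1, e.+1)%:R.
  move=> lt_i; rewrite (@partial_sums_bin e 0) ?add0n ?sz_r //.
  by rewrite bin_small.
have sz_r' : size (partial_sums D0 r) = N by rewrite size_partial_sums.
case: (IHn e.+1 _ sz_r' r'E) => sz_h szE hE.
split; rewrite ?sz_h ?size_partial_sums ?sz_r ?eqxx //.
by case=> [|k] i lt_k lt_i /=; rewrite ?addn0 ?r'E // hE // addSnnS.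
Qed.

Lemma nth_pascal_next x r i : F7 (nth D0 (pascal_next x r) i) =
  F7 (if i is i'.+1 then nth D0 r i' else x) + F7 (nth D0 r i).
Proof.
elim: r x i => [|y r IHr] x [|i] /=; rewrite ?F7D ?nth_nil ?addr0 // IHr.
by case: i.
Qed.

Lemma pascal_rowsP n j r : (forall i, F7 (nth D0 r i) = 'C(j, i)%:R) ->
  size (pascal_rows n r) = n /\
  forall k i, (k < n)%N -> F7 (nth D0 (nth [::] (pascal_rows n r) k) i) = 'C(j + k, i)%:R.
Proof.
elim: n j r => [|n IHn] j r rE //=.
have [i|-> pE] := IHn j.+1 (pascal_next D0 r).
  rewrite nth_pascal_next rE; case: i => [|i]; first by rewrite !bin0 add0r.
  by rewrite rE binS natrD addrC.
by split=> // [[|k]] i lt_k /=; rewrite ?addn0 // pE // addSnnS.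
Qed.

(** * Gaussian elimination *)

Fixpoint pick (rows : seq form) : option (d7 * form * seq form) :=
  if rows is r :: rs then
    match r with
    | [::] => pick rs
    | D0 :: _ => if pick rs is Some (u, p, rs') then Some (u, p, r :: rs') else None
    | u :: p => Some (u, p, rs)
    end
  else None.

(** Tests for full column rank by requiring a pivot in each of the n columns. *)
Fixpoint elim (n : nat) (rows : seq form) : bool :=
  if n is n'.+1 then
    if pick rows is Some (u, p, rs) then
      elim n' [seq axpy (opp7 (mul7 (head D0 r) (inv7 u))) p (behead r) | r <- rs]
    else false
  else true.

Lemma pickP (P : pred form) rows u p rs : pick rows = Some (u, p, rs) ->
  all P rows -> [/\ F7 u != 0, P (u :: p) & all P rs].
Proof.
elim: rows u p rs => [|r rows IHr] u p rs //=.
case: r => [|x r] => [pE /andP[_] | ]; first exact: IHr.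
case: x; try by case=> <- <- <- /andP[].
case pE: (pick rows) => [[[v s] rs']|] // [<- <- <-] /andP[Pr /(IHr _ _ _ pE)[? ? ?]].
by split=> //=; rewrite Pr.
Qed.

(** Clearing the first column leaves rows that vanish at the tail of [env], which is zero by
    induction; the pivot row then kills the first entry. *)
Lemma elim_sound n rows env : size env = n -> elim n rows ->
  all (fun f => ev env f == 0) rows -> env = nseq n 0.
Proof.
elim: n rows env => [|n IHn] rows [|e env] //= [sz_env].
case pE: (pick rows) => [[[u p] rs]|] // el_n /(pickP pE)[nz_u up0 rs0].
have env0 : env = nseq n 0.
  apply: IHn el_n _ => //; rewrite all_map; apply: sub_all rs0 => r /eqP r0 /=.
  have epE : ev env p = - (F7 u * e) by apply/eqP; rewrite -addr_eq0 addrC.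
  rewrite ev_axpy F7N F7M epE mulNr mulrN opprK !mulrA -[_ * _ * F7 u]mulrA.
  rewrite [F7 _ * F7 u]mulrC F7V // mulr1.
  case: r r0 => [|x r] /= r0; last by rewrite r0.
  by rewrite ev0 mul0r addr0.
move: up0 => /=; rewrite env0 ev_zero addr0 mulf_eq0 (negPf nz_u) => /eqP ->.
by [].
Qed.

(** * Elimination weight by weight *)

Definition min_exp (d W : nat) : nat := uphalf (W - d).

(** The exponents j of weight W run from [min_exp d W], where the degree W - 2 j of x^(W - 3 j) y^j
    first is at most d, to W / 3. *)
Definition num_exp (d W : nat) : nat := (W %/ 3).+1 - min_exp d W.

(* The number of b such that W + 7 b < M. *)
Definition num_eqn (M W : nat) : nat := (M - W + 6) %/ 7.

(* [H] holds the forms found for the previous weights W - 5 (e + 1), with the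
   first e + 1 entries dropped: entry b of item e is a_(W - 5 (e + 1), b + e + 1). *)
Fixpoint eliminate (d M nl W : nat) (H : seq (seq form)) (Rs Ps : seq (seq d7)) (np : nat) :
    seq form * nat :=
  if nl is nl'.+1 then
    let B := num_eqn M W in
    let t := history_sum Rs H (nseq B [::]) in
    let: (a, c, n) :=
      level_step (W %/ 3).+1 B (num_exp d W) (behead (nth [::] Ps (min_exp d W))) t [::] np in
    let: (c', n') := eliminate d M nl' (W + 5) (map behead (a :: H)) Rs Ps n in
    (c ++ c', n')
  else ([::], np).

(** Here [chi] is a class modulo 5, [nl] the number of weights treated in it, [N] a bound on the
    number of equations per weight, and [np] the number of tabulated rows of Pascal's triangle. *)
Definition check_elimination (d M N nl np chi : nat) : bool :=
  let: (c, n) :=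
    eliminate d M nl chi [::] (bin_diagonals nl (nseq N D1)) (pascal_rows np [:: D1]) 0 in
  elim n c.

Definition taylor_coef (c : nat -> nat -> 'F_7) (W n : nat) : 'F_7 :=
  \sum_(j < (W %/ 3).+1) c (W - 3 * j)%N j * 'C(j, n)%:R.

Definition reduced_coef (c : nat -> nat -> 'F_7) (d W n : nat) : 'F_7 :=
  \sum_(j < num_exp d W)
     c (W - 3 * (min_exp d W + j))%N (min_exp d W + j)%N * 'C(j, n)%:R.

(** The matrix of the 'C(j, n) is unitriangular: the equation n = N - 1 isolates the last entry. *)
Lemma sum_bin_inj (N : nat) (v : nat -> 'F_7) :
  (forall n, \sum_(j < N) v j * 'C(j, n)%:R = 0) -> forall j, (j < N)%N -> v j = 0.
Proof.
elim: N => // N IHN sum0.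
have vN : v N = 0.
  have := sum0 N; rewrite big_ord_recr /= binn mulr1 big1 ?add0r // => j _.
  by rewrite bin_small ?mulr0.
move=> j; rewrite ltnS leq_eqVlt => /predU1P[-> //|]; apply: IHN => n.
by have := sum0 n; rewrite big_ord_recr /= vN mul0r addr0.
Qed.

Lemma sum_ord_shift (R : nmodType) (v : nat -> R) (m n : nat) :
  (forall j, (j < m)%N -> v j = 0) ->
  \sum_(j < m + n) v j = \sum_(j < n) v (m + j)%N.
Proof. by move=> v0; rewrite big_split_ord /= big1 ?add0r // => j _; apply: v0. Qed.

(** Only j >= j0 contribute, and Vandermonde's identity expands 'C(j0 + j, n) into the products
    'C(j0, k) 'C(j, n - k). *)
Lemma taylor_coef_conv c d row W n :
  (forall i j, (d < i + j)%N -> c i j = 0) ->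
  (forall k, F7 (nth D0 row k) = 'C(min_exp d W, k)%:R) ->
  taylor_coef c W n = conv_bin (behead row) (reduced_coef c d W) n.
Proof.
move=> supp rowE.
have avE : taylor_coef c W n = \sum_(j < num_exp d W)
    c (W - 3 * (min_exp d W + j))%N (min_exp d W + j)%N * 'C(min_exp d W + j, n)%:R.
  have c0 j : (j < min_exp d W)%N -> (j <= W %/ 3)%N -> c (W - 3 * j)%N j = 0.
    by rewrite /min_exp => ? ?; apply: supp; lia.
  rewrite /taylor_coef /num_exp; case: (leqP (min_exp d W) (W %/ 3).+1) => [le_j|lt_j].
    rewrite -(@sum_ord_shift _ (fun j => c (W - 3 * j)%N j * 'C(j, n)%:R)).
      by rewrite subnKC.
    by move=> j lt_j; rewrite c0 ?mul0r //; lia.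
  have -> : ((W %/ 3).+1 - min_exp d W = 0)%N by lia.
  by rewrite big_ord0 big1 // => j _; rewrite c0 ?mul0r //; have := ltn_ord j; lia.
have -> : conv_bin (behead row) (reduced_coef c d W) n =
    \sum_(k < n.+1) 'C(min_exp d W, k)%:R * reduced_coef c d W (n - k)%N.
  rewrite /conv_bin big_ord_recl subn0 bin0 mul1r; congr (_ + _); apply: eq_bigr => k _.
  by rewrite nth_behead rowE.
rewrite avE; under [RHS]eq_bigr do rewrite mulr_sumr.
rewrite exchange_big /=; apply: eq_bigr => j _.
rewrite -binomial.Vandermonde natr_sum mulr_sumr; apply: eq_bigr => k _.
by rewrite natrM mulrCA.
Qed.

(** The values that the solution [c] gives to the parameters introduced by [level_step] at weight
    W. *)
Definition new_params (c : nat -> nat -> 'F_7) (d M W : nat) : seq 'F_7 :=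
  mkseq (fun i => reduced_coef c d W (num_eqn M W + i)) (num_exp d W - num_eqn M W).

Fixpoint params (c : nat -> nat -> 'F_7) (d M nl W : nat) : seq 'F_7 :=
  if nl is nl'.+1 then new_params c d M W ++ params c d M nl' (W + 5) else [::].

(** One environment serves the whole run: [pre] holds the parameters of the earlier weights,
    [params] those of the current and later ones. By the last clause all Taylor coefficients vanish
    once the parameters do. *)
Lemma eliminate_sound c d M N nl W H Rs Ps np pre (env := pre ++ params c d M nl W) :
  (forall i j, (d < i + j)%N -> c i j = 0) ->
  (forall W b, (b < num_eqn M W)%N ->
     \sum_(e < (W %/ 5).+1) 'C(b + e, e)%:R * taylor_coef c (W - 5 * e) (b + e) = 0) ->
  size pre = np -> (M + 6 <= 7 * N)%N ->
  all (fun s => size s == N) Rs -> (size H + nl <= size Rs)%N ->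
  (forall e b, (e < size Rs)%N -> (b < N)%N ->
     F7 (nth D0 (nth [::] Rs e) b) = 'C(b + e.+1, e.+1)%:R) ->
  (forall j k, (j < size Ps)%N -> F7 (nth D0 (nth [::] Ps j) k) = 'C(j, k)%:R) ->
  (W + 5 * nl - d < 2 * size Ps)%N ->
  (W %/ 5 = size H)%N ->
  (forall e b, (e < size H)%N -> 
     ev env (nth [::] (nth [::] H e) b) = taylor_coef c (W - 5 * e.+1) (b + e.+1)) ->
  let: (cs, n) := eliminate d M nl W H Rs Ps np in
  [/\ all (fun f => ev env f == 0) cs, n = size env &
      forall i n, (i < nl)%N -> exists f, taylor_coef c (W + 5 * i) n = ev env f].
Proof.
move=> supp eqns; rewrite {}/env => sz_pre le_N sz_Rs + RsE PsE.
elim: nl W H np pre sz_pre => [|nl IHnl] W H np pre sz_pre le_l lt_W WH HE /=.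
  by rewrite cats0 sz_pre.
set env := pre ++ _ in HE *.
set q := reduced_coef c d W; set B := num_eqn M W.
have Ps_j k : F7 (nth D0 (nth [::] Ps (min_exp d W)) k) = 'C(min_exp d W, k)%:R.
  by apply: PsE; rewrite /min_exp; lia.
have avE n := taylor_coef_conv n supp Ps_j.
have le_B : (B <= N)%N by rewrite /B /num_eqn; lia.
have := @level_step_sound env (behead (nth [::] Ps (min_exp d W))) q (W %/ 3).+1 B (num_exp d W)
  (history_sum Rs H (nseq B [::])) [::] np 0 erefl.
case: (level_step _ _ _ _ _ _ _) => [[a cs] n] [] //.
- move=> i le_i lt_i; rewrite /env /= -sz_pre nth_cat ltnNge leq_addr /= addKn.
  rewrite nth_cat size_mkseq -/B ltn_sub2r //; last exact: leq_ltn_trans le_i lt_i.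
  by rewrite nth_mkseq ?subnKC // -/B ltn_sub2r //; exact: leq_ltn_trans le_i lt_i.
- move=> i le_i; rewrite /q /reduced_coef add0n big1 // => j _.
  by rewrite bin_small ?mulr0 //; apply: leq_trans le_i.
(* The term e = 0 of the equation of order i is a_(W, i) itself, with coefficient 1. *)
- move=> i lt_i lt_iW; rewrite add0n -avE ev_history_sum ?size_nseq //; last first.
  + by apply: sub_all sz_Rs => s /eqP ->.
  + by apply: leq_trans le_l; rewrite leq_addr.
  rewrite nth_nseq if_same ev0 sub0r.
  have := eqns W i lt_i; rewrite WH big_ord_recl /= bin0 mul1r muln0 subn0 addn0.
  move/eqP; rewrite addr_eq0 => /eqP ->; congr (- _); apply: eq_bigr => e _.
  rewrite RsE ?HE //.
  + exact: leq_trans (ltn_ord e) (leq_trans (leq_addr _ _) le_l).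
  + exact: leq_trans le_B.
- by rewrite /num_exp leq_subr.
move=> sz_a aE cs0 nE.
(* Past the end of [a] the default zero form is right, since 'C(j, i) = 0 for j <= W / 3 < i. *)
have aE' i : ev env (nth [::] a i) = taylor_coef c W i.
  case: (ltnP i (W %/ 3).+1) => [lt_i|le_i]; first by rewrite aE // add0n avE.
  rewrite nth_default ?sz_a // ev0 /taylor_coef big1 // => j _.
  by rewrite bin_small ?mulr0 //; apply: leq_trans le_i.
have envE : env = (pre ++ new_params c d M W) ++ params c d M nl (W + 5) by rewrite -catA.
have := IHnl (W + 5)%N (map behead (a :: H)) n (pre ++ new_params c d M W).
rewrite -envE; case: (eliminate _ _ _ _ _ _ _ _) => [cs' n'] [].
- by rewrite size_cat size_mkseq sz_pre nE.
- by rewrite /= size_map addSnnS.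
- by lia.
- by rewrite /= size_map -WH; lia.
- case=> [|e] b lt_e /=; first by rewrite nth_behead aE' muln1 addnK addn1.
  rewrite (nth_map [::]) ?nth_behead; last by move: lt_e; rewrite /= size_map.
  rewrite HE; last by move: lt_e; rewrite /= size_map.
  by congr (taylor_coef c _ _); lia.
move=> cs'0 n'E avW; split=> //; first by rewrite all_cat cs0.
case=> [|i] k lt_i; first by exists (nth [::] a k); rewrite muln0 addn0 aE'.
have [f fE] := avW i k lt_i; exists f; rewrite -fE; congr (taylor_coef c _ _); lia.
Qed.

Lemma check_elimination_sound c d M N nl np chi :
  (forall i j, (d < i + j)%N -> c i j = 0) ->
  (forall W b, (b < num_eqn M W)%N ->
     \sum_(e < (W %/ 5).+1) 'C(b + e, e)%:R * taylor_coef c (W - 5 * e) (b + e) = 0) ->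
  (M + 6 <= 7 * N)%N -> (chi + 5 * nl - d < 2 * np)%N -> (chi < 5)%N ->
  check_elimination d M N nl np chi -> forall i n, (i < nl)%N -> taylor_coef c (chi + 5 * i) n = 0.
Proof.
move=> supp eqns le_N le_np lt_chi; rewrite /check_elimination.
have [|sz_h sz_hr hE] := @bin_diagonalsP N nl 0 (nseq N D1) (size_nseq _ _).
  by move=> i lt_i; rewrite nth_nseq lt_i addn0 bin0.
have [|sz_p pE] := @pascal_rowsP np 0 [:: D1].
  by move=> [|i] /=; rewrite ?nth_nil.
have := @eliminate_sound c d M N nl chi [::] (bin_diagonals nl (nseq N D1))
  (pascal_rows np [:: D1]) 0 [::] supp eqns erefl le_N sz_hr.
case: (eliminate _ _ _ _ _ _ _ _) => [cs m] [] //.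
- by rewrite sz_h.
- by move=> e b; rewrite sz_h => lt_e lt_b; rewrite hE.
- by move=> j k; rewrite sz_p => lt_j; rewrite pE.
- by rewrite sz_p.
- by rewrite divn_small.
move=> cs0 mE avE el_m i n /avE - /(_ n)[f ->].
by rewrite (elim_sound (esym mE) el_m cs0) ev_zero.
Qed.

(** 110 weights in steps of 5 cover all W < 550, beyond the largest weight 3 * 174 = 522. The tables
    suffice as 550 + 6 <= 7 * 80 and 4 + 550 - 174 < 2 * 200. *)
Lemma check_elimination_174_550 chi : (chi < 5)%N -> check_elimination 174 550 80 110 200 chi.
Proof.
case: chi => [|[|[|[|[|chi]]]]] lt_chi; last by [].
all: vm_cast_no_check (erefl true).
Qed.

Lemma level_system_trivial (c : nat -> nat -> 'F_7) :
  (forall i j, (174 < i + j)%N -> c i j = 0) ->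
  (forall W b, (b < num_eqn 550 W)%N ->
     \sum_(e < (W %/ 5).+1) 'C(b + e, e)%:R * taylor_coef c (W - 5 * e) (b + e) = 0) ->
  forall i j, c i j = 0.
Proof.
move=> supp eqns.
have av0 W n : (W < 550)%N -> taylor_coef c W n = 0.
  move=> lt_W; have lt5 : (W %% 5 < 5)%N by rewrite ltn_pmod.
  rewrite [in LHS](divn_eq W 5) addnC mulnC.
  apply: (check_elimination_sound supp eqns _ _ lt5 (check_elimination_174_550 lt5)) => //; lia.
move=> i j; case: (ltnP 174 (i + j)) => [|le_ij]; first exact: supp.
rewrite -[i in c i j](addnK (3 * j)%N).
apply: (@sum_bin_inj ((i + 3 * j) %/ 3).+1 (fun j' => c (i + 3 * j - 3 * j')%N j')).
  by move=> n; apply: (av0 (i + 3 * j)%N); lia.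
by rewrite ltnS leq_divRL // mulnC leq_addl.
Qed.

(** * Collapse of the points modulo 7 *)

(** A range of summation independent of the exponent allows sums to be exchanged. *)
Lemma exprDn_wide (R : comNzRingType) (x y : R) (n N : nat) : (n < N)%N ->
  (x + y) ^+ n = \sum_(i < N) (x ^+ (n - i) * y ^+ i) *+ 'C(n, i).
Proof.
move=> lt_n; rewrite exprDn (big_ord_widen N (fun i => (x ^+ (n - i) * y ^+ i) *+ 'C(n, i))) //.
rewrite big_mkcond /=; apply: eq_bigr => i _; case: ifP => // /negbT.
by rewrite -leqNgt => le_i; rewrite bin_small.
Qed.

(** Both sides are the trinomial coefficient j! / (b! e! (j - b - e)!). *)
Lemma mul_bin_trinomial (j b e : nat) :
  ('C(j, b) * 'C(j - b, e) = 'C(b + e, b) * 'C(j, b + e))%N.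
Proof.
case: (leqP (b + e) j) => [le_j|lt_j]; last first.
  rewrite (bin_small lt_j) muln0; case: (leqP b j) => [le_b|lt_b].
    by rewrite (@bin_small (j - b)) ?muln0 //; lia.
  by rewrite bin_small.
have le_b : (b <= j)%N by lia.
have le_e : (e <= j - b)%N by lia.
apply/eqP; rewrite -(eqn_pmul2r (fact_gt0 b)) -(eqn_pmul2r (fact_gt0 e)).
rewrite -(eqn_pmul2r (fact_gt0 (j - (b + e)))); apply/eqP.
have E1 := bin_fact le_b; have E2 := bin_fact le_e.
have E3 := bin_fact le_j; have E4 := bin_fact (leq_addr e b).
rewrite addKn in E4; rewrite subnDA in E3 *.
transitivity (j`!)%N; first by rewrite -E1 -E2; ring.
by rewrite -E3 -E4; ring.
Qed.

(** The cofactor has to be exact: divisibility up to a scalar, as given by pseudo-division over the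
    integers, would not survive reduction modulo 7. *)
Definition pdivides (R : nzRingType) (D p : {poly R}) : Prop := exists q, p = q * D.

Lemma pdivides_sum (R : nzRingType) (I : Type) (r : seq I) (P : pred I) (D : {poly R}) F :
  (forall i, P i -> pdivides D (F i)) -> pdivides D (\sum_(i <- r | P i) F i).
Proof.
move=> dF; elim/big_ind: _ => //; first by exists 0; rewrite mul0r.
by move=> p q [p' ->] [q' ->]; exists (p' + q'); rewrite mulrDl.
Qed.

(* The coefficient of z^b in f (x, g x + z), where f = \sum c_ij x^i y^j. *)
Definition normal_coef (R : comNzRingType) (N : nat) (c : nat -> nat -> R)
    (g : {poly R}) (b : nat) : {poly R} :=
  \sum_(i < N) \sum_(j < N) (c i j * 'C(j, b)%:R)%:P * ('X^i * g ^+ (j - b)).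

(** Taylor expansion of f at (t, s): the inner double sum is the coefficient of order (al, b + be),
    and (x - t)^al (h + z)^(b + be) contributes 'C(b + be, b) (x - t)^al h^be to z^b. *)
Lemma normal_coef_expand (R : comNzRingType) N (c : nat -> nat -> R) (g h : {poly R}) t s b :
  g = s%:P + h ->
  normal_coef N c g b = \sum_(al < N) \sum_(be < N)
    (\sum_(i < N) \sum_(j < N) c i j * ('C(i, al) * 'C(j, b + be))%:R
       * (t ^+ (i - al) * s ^+ (j - (b + be))))%:P
    * 'C(b + be, b)%:R * (('X - t%:P) ^+ al * h ^+ be).
Proof.
move=> gE; rewrite /normal_coef.
under [RHS]eq_bigr => al _.
  under eq_bigr => be _.
    rewrite rmorph_sum !mulr_suml.
    under eq_bigr do rewrite rmorph_sum !mulr_suml.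
    over.
  rewrite exchange_big.
  under eq_bigr do rewrite exchange_big.
  over.
rewrite [RHS]exchange_big; apply: eq_bigr => i _.
rewrite [RHS]exchange_big; apply: eq_bigr => j _ /=.
have -> : 'X^i = (t%:P + ('X - t%:P)) ^+ i by rewrite addrC subrK.
rewrite (exprDn_wide _ _ (ltn_ord i)) mulr_suml mulr_sumr; apply: eq_bigr => al _.
have lt_jb : (j - b < N)%N by apply: leq_ltn_trans (leq_subr _ _) (ltn_ord j).
rewrite gE (exprDn_wide _ _ lt_jb) !mulr_sumr; apply: eq_bigr => be _.
have binE : 'C(j, b)%:R * 'C(j - b, be)%:R = 'C(b + be, b)%:R * 'C(j, b + be)%:R :> {poly R}.
  by rewrite -!natrM mul_bin_trinomial.
rewrite -[_ *+ 'C(i, al)]mulr_natr -[_ *+ 'C(j - b, be)]mulr_natr.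
rewrite !rmorphM /= !rmorphXn /= !polyC_natr. rewrite subnDA.
transitivity ((c i j)%:P * ('C(j, b)%:R * 'C(j - b, be)%:R) * 'C(i, al)%:R *
  (t%:P ^+ (i - al) * s%:P ^+ (j - b - be)) * (('X - t%:P) ^+ al * h ^+ be)); first by ring.
by rewrite binE; ring.
Qed.

(** As x - t divides g - g(t), the term of order (al, b + be) is divisible by (x - t)^(al + be), and
    it vanishes when al + be < m - b. *)
Lemma pdivides_normal_coef (R : comNzRingType) N m (c : nat -> nat -> R) (g : {poly R}) t :
  (forall al be, (al + be < m)%N ->
     \sum_(i < N) \sum_(j < N) c i j * ('C(i, al) * 'C(j, be))%:R
       * (t ^+ (i - al) * g.[t] ^+ (j - be)) = 0) ->
  forall b, pdivides (('X - t%:P) ^+ (m - b)) (normal_coef N c g b).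
Proof.
move=> conds b.
have /factor_theorem[h gE] : root (g - (g.[t])%:P) t.
  by rewrite /root hornerD hornerN hornerC subrr.
rewrite (@normal_coef_expand _ N c g (h * ('X - t%:P)) t g.[t]); last first.
  by rewrite -gE addrC subrK.
apply: pdivides_sum => al _; apply: pdivides_sum => be _.
case: (ltnP (al + (b + be)) m) => [lt_m|le_m].
  by rewrite conds // polyC0 !mul0r; exists 0; rewrite mul0r.
have le_m' : (m - b <= al + be)%N by lia.
rewrite exprMn [_ ^+ al * (_ * _)]mulrCA -exprD -(subnK le_m') exprD !mulrA.
by eexists; reflexivity.
Qed.

(** Since p does not vanish at t, q does; factors x - t are split off one at a time, which stays
    exact over a domain. *)
Lemma pdivides_Xsub_cancel (R : idomainType) (p q : {poly R}) (t : R) e :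
  p.[t] != 0 -> pdivides (('X - t%:P) ^+ e) (q * p) -> pdivides (('X - t%:P) ^+ e) q.
Proof.
move=> nz_pt; elim: e q => [|e IHe] q [r rE]; first by exists q; rewrite mulr1.
have /factor_theorem[q1 q1E] : root q t.
  have := congr1 (horner^~ t) rE; rewrite exprS !hornerM hornerXsubC subrr mul0r mulr0.
  by move/eqP; rewrite mulf_eq0 (negPf nz_pt) orbF.
have [|r1 r1E] := IHe q1.
  exists r; apply: (mulIf (monic_neq0 (monicXsubC t))).
  by rewrite -[RHS]mulrA -exprSr -rE q1E mulrAC.
by exists r1; rewrite q1E r1E exprSr mulrA.
Qed.

Lemma pdivides_prod (R : idomainType) (g : {poly R}) (t : nat -> R) e n :
  injective t -> (forall l, (l < n)%N -> pdivides (('X - (t l)%:P) ^+ e) g) ->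
  pdivides (\prod_(l < n) ('X - (t l)%:P) ^+ e) g.
Proof.
move=> t_inj; elim: n => [|n IHn] dvd_g.
  by exists g; rewrite big_ord0 mulr1.
have [|q qE] := IHn; first by move=> l lt_l; apply: dvd_g; apply: ltnW.
have [||r rE] := @pdivides_Xsub_cancel _ (\prod_(l < n) ('X - (t l)%:P) ^+ e) q (t n) e.
- rewrite horner_prod; apply/prodf_neq0 => l _.
  by rewrite horner_exp hornerXsubC expf_neq0 // subr_eq0 (inj_eq t_inj) gtn_eqF.
- by rewrite -qE; apply: dvd_g.
by exists r; rewrite big_ord_recr /= qE rE mulrAC mulrA.
Qed.

Lemma sum_ord_wide (R : nmodType) (F : nat -> R) (m n : nat) : (m <= n)%N ->
  (forall i, (m <= i)%N -> F i = 0) -> \sum_(i < m) F i = \sum_(i < n) F i.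
Proof.
move=> le_mn F0; rewrite (big_ord_widen n F) // big_mkcond; apply: eq_bigr => i _.
by case: ltnP => // le_i; rewrite F0.
Qed.

Lemma coef_curve_pow (R : comNzRingType) (i n k E : nat) : (n < E)%N ->
  ('X^i * ('X^3 + 'X^8) ^+ n : {poly R})`_k =
  \sum_(e < E) 'C(n, e)%:R * (k == i + 3 * n + 5 * e)%N%:R.
Proof.
move=> lt_n; have -> : 'X^3 + 'X^8 = 'X^3 * (1 + 'X^5) :> {poly R}.
  by rewrite mulrDr mulr1 -exprD.
rewrite exprMn (exprDn_wide _ _ lt_n) !mulr_sumr coef_sum; apply: eq_bigr => e _.
by rewrite expr1n mul1r -!exprM !mulrnAr mulrA -!exprD coefMn coefXn mulr1 mulrnAC.
Qed.

(** By g = x^3 (1 + x^5), a monomial x^i y^j reaches x^(W - 3 b) z^b only if i + 3 j = W - 5 e,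
    where e counts the factors x^5. *)
Lemma coef_normal_coef (N W b : nat) (c : nat -> nat -> 'F_7) :
  (forall i j, (N <= i + j)%N -> c i j = 0) -> (3 * b <= W)%N ->
  (normal_coef N c ('X^3 + 'X^8) b)`_(W - 3 * b) =
  \sum_(e < (W %/ 5).+1) 'C(b + e, e)%:R * taylor_coef c (W - 5 * e) (b + e).
Proof.
move=> supp le_b; pose E := (N + W).+1.
(* The guard excludes truncated subtractions, and [E] exceeds every range of summation involved. *)
pose T e j := if (3 * j + 5 * e <= W)%N
  then 'C(b + e, e)%:R * (c (W - 5 * e - 3 * j)%N j * 'C(j, b + e)%:R) else 0.
transitivity (\sum_(e < E) \sum_(j < N) T e j).
  rewrite /normal_coef coef_sum.
  under eq_bigr do rewrite coef_sum.
  rewrite exchange_big [RHS]exchange_big; apply: eq_bigr => j _ /=.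
  have lt_jE : (j - b < E)%N by have := ltn_ord j; rewrite /E; lia.
  under eq_bigr do rewrite coefCM (coef_curve_pow _ _ _ lt_jE) mulr_sumr.
  rewrite exchange_big; apply: eq_bigr => e _ /=; rewrite /T.
  case: (ltnP j b) => [lt_j|le_j].
    rewrite (@bin_small j (b + e)) ?(ltn_addr _ lt_j) // !mulr0 if_same big1 // => i _.
    by rewrite bin_small // mulr0 mul0r.
  have binE : 'C(j, b)%:R * 'C(j - b, e)%:R = 'C(b + e, e)%:R * 'C(j, b + e)%:R :> 'F_7.
    by rewrite -!natrM mul_bin_trinomial -(bin_sub (leq_addl b e)) addnK.
  case: ifP => [le_W|/negbT gt_W]; last first.
    rewrite big1 // => i _; case: eqP => [eqW|]; last by rewrite !mulr0.
    by case/negP: gt_W; lia.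
  case: (ltnP (W - 5 * e - 3 * j) N) => [lt_N|le_N].
    rewrite (bigD1 (Ordinal lt_N)) //= big1 ?addr0 => [|i ne_i].
      have -> : (W - 3 * b == W - 5 * e - 3 * j + 3 * (j - b) + 5 * e)%N by lia.
      by rewrite mulr1 -mulrA binE mulrCA mulrA.
    case: eqP => [eqW|]; last by rewrite !mulr0.
    by case/eqP: ne_i; apply: val_inj => /=; lia.
  rewrite supp ?(leq_trans le_N) ?leq_addr // mul0r mulr0 big1 // => i _.
  case: eqP => [eqW|]; last by rewrite !mulr0.
  by have := ltn_ord i; lia.
apply: etrans (_ : \sum_(e < E) \sum_(j < E) T e j = _).
  apply: eq_bigr => e _; apply: sum_ord_wide; first by rewrite /E; lia.
  move=> j le_j; rewrite /T; case: ifP => // _.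
  by rewrite supp ?mul0r ?mulr0 // (leq_trans le_j) ?leq_addl.
rewrite -(@sum_ord_wide _ (fun e => \sum_(j < E) T e j) (W %/ 5).+1 E); last 2 first.
- by rewrite /E; lia.
- by move=> e le_e; rewrite big1 // => j _; rewrite /T; case: ifP => //; lia.
apply: eq_bigr => e _; rewrite /taylor_coef mulr_sumr.
rewrite -(@sum_ord_wide _ (T e) ((W - 5 * e) %/ 3).+1 E); last 2 first.
- by rewrite /E; lia.
- by move=> j le_j; rewrite /T; case: ifP => //; lia.
by apply: eq_bigr => j _; rewrite /T ifT //; have := ltn_ord j; have := ltn_ord e; lia.
Qed.

Lemma map_normal_coef (R S : comNzRingType) (f : {rmorphism R -> S}) N c g b :
  map_poly f (normal_coef N c g b) =
  normal_coef N (fun i j => f (c i j)) (map_poly f g) b.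
Proof.
rewrite rmorph_sum; apply: eq_bigr => i _; rewrite rmorph_sum; apply: eq_bigr => j _.
rewrite rmorphM /= map_polyC /= (rmorphM f) rmorph_nat; congr (_ * _).
by rewrite rmorphM /= !rmorphXn /= map_polyX.
Qed.

Lemma mod7_vanish (c : nat -> nat -> int) :
  (forall i j, (174 < i + j)%N -> c i j = 0) ->
  (forall l al be, (l < 10)%N -> (al + be < 55)%N ->
     \sum_(i < 175) \sum_(j < 175) c i j * ('C(i, al) * 'C(j, be))%:R
       * ((7 * l)%:Z ^+ (i - al) * ((7 * l)%:Z ^+ 3 + (7 * l)%:Z ^+ 8) ^+ (j - be)) = 0) ->
  forall i j, (c i j)%:~R = 0 :> 'F_7.
Proof.
move=> supp conds; pose g : {poly int} := 'X^3 + 'X^8.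
have t_inj : injective (fun l => (7 * l)%:Z) by move=> x y []; lia.
pose cb i j : 'F_7 := (c i j)%:~R.
have dvd_b b : pdivides ('X^(10 * (55 - b))) (normal_coef 175 cb ('X^3 + 'X^8) b).
  have [|q qE] := @pdivides_prod _ (normal_coef 175 c g b) _ (55 - b) 10 t_inj.
    move=> l lt_l; apply: pdivides_normal_coef => al be lt_m.
    by rewrite /g hornerD !hornerXn; apply: conds.
  exists (map_poly intr q).
  have -> : 'X^3 + 'X^8 = map_poly intr g :> {poly 'F_7}.
    by rewrite rmorphD /= !map_polyXn.
  rewrite -(map_normal_coef intr) qE rmorphM /=; congr (_ * _).
  (* Modulo 7 each factor X - 7 l becomes X. *)
  rewrite rmorph_prod /= (eq_bigr (fun=> 'X^(55 - b))) => [|l _].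
    by rewrite prodr_const card_ord -exprM mulnC.
  rewrite rmorphXn /= rmorphB /= map_polyX map_polyC /= PoszM intrM.
  have -> : (7%:Z)%:~R = 0 :> 'F_7 by apply/val_inj.
  by rewrite mul0r subr0.
apply: level_system_trivial => [i j lt_ij|W b lt_b]; first by rewrite /cb supp.
case: (leqP (3 * b) W) => [le_b|lt_W]; last first.
  rewrite big1 // => e _; rewrite /taylor_coef big1 ?mulr0 // => j _.
  by rewrite (@bin_small j) ?mulr0 //; have := ltn_ord j; lia.
rewrite -(@coef_normal_coef 175 W b cb) => // [|i j le_ij]; last by rewrite /cb supp.
(* W - 3 b < 10 (55 - b) amounts to W + 7 b < 550. *)
have [q ->] := dvd_b b; rewrite coefMXn ifT //.
by move: lt_b; rewrite /num_eqn; lia.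
Qed.

(** * The matrix of conditions *)

Definition exponents (d : nat) : finType := ('I_d.+1 * 'I_d.+1)%type.
(* [inl (k, a, b)]: the coefficient of u_0^a u_1^b in the expansion at the k-th
   point vanishes, a + b < m. [inr s]: the coefficient of index s vanishes, where
   s is outside of the triangle s_1 + s_2 <= d of actual exponents. *)
Definition condition (n d m : nat) : finType := ('I_n * 'I_m * 'I_m + exponents d)%type.

(** The power of the third coordinate makes the entry homogeneous in [w k]; when that coordinate is
    1, this is the affine Taylor condition. *)
Definition cond_entry (R : nzRingType) (n d m : nat) (w : 'I_n -> 'I_3 -> R)
    (r : condition n d m) (t : exponents d) : R :=
  match r with
  | inl (k, a, b) =>
    if (a + b < m)%N && (t.1 + t.2 <= d)%N then
      ('C(t.1, a) * 'C(t.2, b))%:R *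
      (w k 0 ^+ (t.1 - a) * w k 1 ^+ (t.2 - b) * w k 2%:R ^+ (d - t.1 - t.2))
    else 0
  | inr s => if (d < s.1 + s.2)%N then (s == t)%:R else 0
  end.

Lemma cond_entry_map (R S : nzRingType) (f : {rmorphism R -> S}) n d m w r t :
  f (@cond_entry R n d m w r t) = cond_entry (fun k i => f (w k i)) r t.
Proof.
case: r => [[[k a] b]|s] /=; case: ifP => // _; rewrite ?rmorph0 ?rmorph_nat //.
by rewrite !rmorphM !rmorphXn /= !rmorph_nat.
Qed.

Definition curve_points (R : nzRingType) (n : nat) (k : 'I_n) (i : 'I_3) : R :=
  [:: (7 * k)%:R; (7 * k)%:R ^+ 3 + (7 * k)%:R ^+ 8; 1]`_i.

Arguments curve_points R {n} k i.

Lemma curve_points_map (R S : nzRingType) (f : {rmorphism R -> S}) n k i :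
  f (@curve_points R n k i) = curve_points S k i.
Proof.
rewrite /curve_points; case: i => [[|[|[|//]]] ?] /=; rewrite ?rmorph1 ?rmorph_nat //.
by rewrite rmorphD !rmorphXn /= rmorph_nat.
Qed.

Definition kernel_trivial (R : nzRingType) n d m (w : 'I_n -> 'I_3 -> R) : Prop :=
  forall c : exponents d -> R, (forall r : condition n d m, \sum_t cond_entry w r t * c t = 0) ->
  forall t, c t = 0.

Lemma kernel_dvd7 (c : exponents 174 -> int) :
  (forall r : condition 10 174 55, \sum_t cond_entry (curve_points _) r t * c t = 0) ->
  forall t, (7 %| c t)%Z.
Proof.
move=> ker t.
pose c0 i j := if (i + j <= 174)%N then c (inord i, inord j) else 0.
have supp i j : (174 < i + j)%N -> c0 i j = 0 by rewrite ltnNge /c0 => /negPf ->.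
have cE (s : exponents 174) : (s.1 + s.2 <= 174)%N -> c s = c0 s.1 s.2.
  by move=> le_s; rewrite /c0 le_s !inord_val; case: s {le_s}.
case: (leqP (t.1 + t.2) 174) => [le_t|lt_t]; last first.
  have := ker (inr t); rewrite (bigD1 t) //= lt_t eqxx mul1r big1 => [|s ne_s].
    by rewrite addr0 => ->; apply: dvdz0.
  by rewrite eq_sym (negPf ne_s) mul0r.
have c0_vanish := @mod7_vanish c0 supp.
rewrite (dvdz_pcharf (pchar_Fp (isT : prime 7))) cE // c0_vanish //.
  move=> l al be lt_l lt_m.
  have lt_al : (al < 55)%N by lia.
  have lt_be : (be < 55)%N by lia.
  have ker0 := ker (inl (Ordinal lt_l, Ordinal lt_al, Ordinal lt_be)).
  rewrite pair_bigA -[RHS]ker0; apply: eq_bigr => s _; rewrite /cond_entry /= lt_m.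
  case: leqP => [le_s|lt_s]; last by rewrite supp ?mul0r.
  have -> : curve_points int (Ordinal lt_l) 2%:R = 1 by [].
  by rewrite (cE s) // expr1n mulr1 [curve_points _ _ 0]natz [RHS]mulrC
    [curve_points _ _ 1](congr1 (fun z : int => z ^+ 3 + z ^+ 8) (natz _)) !mulrA.
Qed.

(** The kernel is stable under exact division by 7, so 7^n divides each entry for every n; n = |c t|
    contradicts |c t| < 7^|c t| unless c t = 0. *)
Lemma kernel_trivial_int : kernel_trivial 174 55 (@curve_points int 10).
Proof.
move=> c ker t.
have divs n : forall c : exponents 174 -> int,
    (forall r : condition 10 174 55, \sum_t cond_entry (curve_points _) r t * c t = 0) ->
    forall t, exists c', c t = c' * 7 ^+ n.
  elim: n => [|n IHn] {ker t}c ker t; first by exists (c t); rewrite mulr1.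
  have cE s : c s = (c s %/ 7)%Z * 7 by rewrite divzK // kernel_dvd7.
  have [|c' c'E] := IHn (fun s => c s %/ 7)%Z _ t.
    move=> r; apply: (mulIf (isT : 7%:Z != 0)); rewrite mul0r mulr_suml -[RHS](ker r).
    by apply: eq_bigr => s _; rewrite [in RHS]cE mulrA.
  by exists c'; rewrite cE c'E exprSr mulrA.
have [c' cE] := divs `|c t|%N c ker t.
apply/eqP; apply: contraT => nz_c.
have nz_c' : c' != 0 by apply: contraNneq nz_c => c'0; rewrite cE c'0 mul0r.
have := congr1 absz cE; rewrite abszM abszX /=.
have : (`|c t| < 7 ^ `|c t|)%N by apply: ltn_expl.
have : (0 < `|c'|)%N by rewrite absz_gt0.
by move=> ? lt7 E; move: lt7; rewrite {1}E ltnNge leq_pmull.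
Qed.

(** Multiplying by the product of all denominators leads back to the integers. *)
Lemma kernel_trivial_rat : kernel_trivial 174 55 (@curve_points rat 10).
Proof.
move=> c ker t; pose D := \prod_s denq (c s).
pose z s := numq (c s) * \prod_(s' | s' != s) denq (c s').
have zE s : (z s)%:~R = c s * D%:~R :> rat.
  by rewrite /z /D [in RHS](bigD1 s) //= !intrM numqE mulrA.
have nz_D : D != 0 by apply/prodf_neq0 => s _; rewrite denq_neq0.
have z0 : z t = 0.
  apply: kernel_trivial_int => r; apply: (@intr_inj rat); rewrite rmorph_sum.
  rewrite (eq_bigr (fun s => cond_entry (curve_points rat) r s * c s * D%:~R)) => [|s _].
    by rewrite -mulr_suml ker mul0r.
  rewrite rmorphM /= zE mulrA (cond_entry_map intr); congr (_ * _ * _).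
  case: r => [[[k a] b]|r] //=; case: ifP => // _.
  by rewrite !(curve_points_map intr).
have /eqP := zE t; rewrite z0 eq_sym mulf_eq0 intr_eq0 (negPf nz_D) orbF.
by move/eqP.
Qed.

Definition cond_minor (R : nzRingType) n d m (w : 'I_n -> 'I_3 -> R)
    (g : 'I_#|exponents d| -> condition n d m) : 'M[R]_#|exponents d| :=
  \matrix_(i, j) cond_entry w (g i) (enum_val j).

(** A trivial kernel means full column rank, so some choice of rows is invertible. *)
Lemma kernel_trivial_cond_minor (F : fieldType) n d m (w : 'I_n -> 'I_3 -> F) :
  kernel_trivial d m w ->
  exists g : 'I_#|exponents d| -> condition n d m, \det (cond_minor w g) != 0.
Proof.
move=> ker0.
pose A : 'M[F]_(#|condition n d m|, #|exponents d|) :=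
  \matrix_(i, j) cond_entry w (enum_val i) (enum_val j).
have fullA : row_full A.
  rewrite /row_full -mxrank_tr -/(row_free _) -kermx_eq0; apply/eqP/row_matrixP => i.
  apply/rowP => j; rewrite row0 [RHS]mxE -(enum_valK j).
  apply: (ker0 (fun t => row i (kermx A^T) 0 (enum_rank t))) => r.
  have /sub_kermxP/rowP/(_ (enum_rank r)) := row_sub i (kermx A^T).
  rewrite !mxE => kerE; rewrite -[RHS]kerE [in RHS](reindex enum_rank) /=; last first.
    by apply: onW_bij; exact: enum_rank_bij.
  by apply: eq_bigr => t _; rewrite !mxE !enum_rankK mulrC.
exists (fun i => enum_val (fullrankfun fullA i)).
have := fullrowsub_unit fullA; rewrite unitmxE unitfE.
by congr (\det _ != 0); apply/matrixP => i j; rewrite !mxE.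
Qed.

Lemma cond_minor_kernel_trivial (F : fieldType) n d m (w : 'I_n -> 'I_3 -> F)
    (g : 'I_#|exponents d| -> condition n d m) :
  \det (cond_minor w g) != 0 -> kernel_trivial d m w.
Proof.
rewrite -unitfE -unitmxE => unit_g c ker t.
pose v : 'cV_#|exponents d| := \col_j c (enum_val j).
have gv0 : cond_minor w g *m v = 0.
  apply/colP => i; rewrite !mxE -[RHS](ker (g i)) (reindex enum_rank) /=; last first.
    by apply: onW_bij; exact: enum_rank_bij.
  by apply: eq_bigr => s _; rewrite !mxE !enum_rankK.
have := mulKmx unit_g v; rewrite gv0 mulmx0 => /colP/(_ (enum_rank t)).
by rewrite !mxE enum_rankK.
Qed.

Lemma cond_minor_map (R S : nzRingType) (f : {rmorphism R -> S}) n d m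
    (w : 'I_n -> 'I_3 -> R) (g : 'I_#|exponents d| -> condition n d m) :
  map_mx f (cond_minor w g) = cond_minor (fun k i => f (w k i)) g.
Proof. by apply/matrixP => i j; rewrite !mxE cond_entry_map. Qed.

Lemma eq_cond_minor (R : nzRingType) n d m (w w' : 'I_n -> 'I_3 -> R)
    (g : 'I_#|exponents d| -> condition n d m) :
  w =2 w' -> cond_minor w g = cond_minor w' g.
Proof.
move=> ww'; apply/matrixP => i j; rewrite !mxE /cond_entry.
by case: (g i) => [[[k a] b]|s] //; rewrite !ww'.
Qed.

(** A minor nonzero over the rationals stays nonzero in characteristic 0. *)
Lemma curve_points_minor (K : numFieldType) :
  exists g : 'I_#|exponents 174| -> condition 10 174 55,
    \det (cond_minor (@curve_points K 10) g) != 0.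
Proof.
have [g nz_g] := kernel_trivial_cond_minor kernel_trivial_rat; exists g.
rewrite -(@eq_cond_minor _ _ _ _ (fun k i => ratr (curve_points rat k i))).
  by rewrite -cond_minor_map det_map_mx fmorph_eq0.
by move=> k i; rewrite curve_points_map.
Qed.

(** * General points *)

(** Registered below as a measure, it reduces multihomogeneity to weighted homogeneity for each
    i. *)
Definition row_deg (n : nat) (i : 'I_n) (mo : 'X_{1..n * 3}) : nat :=
  \sum_(j < 3) mo (mxvec_index i j).

Lemma row_deg0 n i : @row_deg n i 0%MM = 0%N.
Proof. by rewrite /row_deg big1 // => j _; rewrite mnm0E. Qed.

Lemma row_degD n i : {morph @row_deg n i : m1 m2 / (m1 + m2)%MM >-> (m1 + m2)%N}.
Proof.
by move=> m1 m2; rewrite /row_deg -big_split; apply: eq_bigr => j _; rewrite mnmDE.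
Qed.

HB.instance Definition _ (n : nat) (i : 'I_n) :=
  isMeasure.Build (n * 3)%N (@row_deg n i) (row_deg0 i) (@row_degD n i).

Lemma multihomogP (K : fieldType) n (e : 'I_n -> nat) (G : {mpoly K[n * 3]}) :
  (forall i, G \is (e i).-homog for (@row_deg n i)) -> multihomog e G.
Proof. by move=> homG mo mo_G i; apply: (dhomogP _ _ _ (homG i)). Qed.

Lemma prod_dhomog n (R : nzRingType) (mf : measure n) (N : nat)
    (D : 'I_N -> nat) (F : 'I_N -> {mpoly R[n]}) :
  (forall j, F j \is (D j).-homog for mf) ->
  \prod_j F j \is (\sum_j D j).-homog for mf.
Proof.
move=> homF; elim/big_rec2: _ => [|j D' F' _ IH]; first exact: dhomog1.
exact: dhomogM.
Qed.

Definition coord_var (K : fieldType) n (k : 'I_n) (i : 'I_3) : {mpoly K[n * 3]} :=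
  'X_(mxvec_index k i).

(** This degree depends on the row and not on the column, so all terms in the expansion of a minor
    share one multidegree. *)
Definition cond_deg n d m (r : condition n d m) (i : 'I_n) : nat :=
  if r is inl (k, a, b) then (if k == i then d - a - b else 0)%N else 0%N.

Lemma cond_entry_dhomog (K : fieldType) n d m (r : condition n d m) t i :
  cond_entry (@coord_var K n) r t \is (cond_deg r i).-homog for (@row_deg n i).
Proof.
have varE k j e : coord_var K k j ^+ e \is ((k == i) * e).-homog for (@row_deg n i).
  apply: dhomogMn; rewrite /coord_var dhomogX /= /row_deg.
  rewrite (eq_bigr (fun j' => (k == i) && (j == j') : nat)) => [|j' _]; last first.
    rewrite mnm1E; congr (nat_of_bool _); apply/eqP/andP => [/cast_ord_inj/enum_rank_inj[-> ->] //|].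
    by case=> /eqP-> /eqP->.
  case: (k == i) => /=; last by rewrite big1.
  by rewrite (bigD1 j) //= eqxx big1 ?addn0 // => j' /negPf; rewrite eq_sym => ->.
case: r => [[[k a] b]|s] /=; last first.
  by case: ifP; rewrite ?dhomog0 //; case: eqP; rewrite ?dhomog0 ?dhomog1.
case: ifP => [/andP[_ le_t]|_]; last exact: dhomog0.
(* When a subtraction is truncated the binomial factor is 0, and 0 is homogeneous of any degree. *)
case: (leqP a t.1) => [le_a|lt_a]; last by rewrite bin_small // mul0r dhomog0.
case: (leqP b t.2) => [le_b|lt_b]; last by rewrite (@bin_small t.2) // muln0 mul0r dhomog0.
rewrite mulr_natl; apply: rpredMn.
have := dhomogM (dhomogM (varE k 0 (t.1 - a)%N) (varE k 1 (t.2 - b)%N))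
  (varE k 2%:R (d - t.1 - t.2)%N).
have degE x y a' b' : (a' <= x -> b' <= y -> x + y <= d ->
    x - a' + (y - b') + (d - x - y) = d - a' - b')%N by lia.
by case: (k == i); rewrite ?mul1n ?mul0n ?degE.
Qed.

Lemma det_cond_minor_multihomog (K : fieldType) n d m (g : 'I_#|exponents d| -> condition n d m) :
  multihomog (fun i => \sum_j cond_deg (g j) i)%N (\det (cond_minor (@coord_var K n) g)).
Proof.
apply: multihomogP => i; apply: rpred_sum => s _; rewrite -signr_odd mulr_sign.
have homP : \prod_j cond_minor (@coord_var K n) g j (s j)
    \is (\sum_j cond_deg (g j) i).-homog for (@row_deg n i).
  by apply: prod_dhomog => j; rewrite mxE; apply: cond_entry_dhomog.
by case: ifP => _ //; rewrite dhomogN.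
Qed.

Lemma meval_det_cond_minor (K : fieldType) n d m (g : 'I_#|exponents d| -> condition n d m)
    (M : 'M[K]_(n, 3)) :
  (\det (cond_minor (@coord_var K n) g)).@[mxvec M 0] = \det (cond_minor (fun k i => M k i) g).
Proof.
rewrite -det_map_mx cond_minor_map; congr (\det _); apply: eq_cond_minor => k i.
by rewrite /coord_var /= mevalXU mxvecE.
Qed.

Lemma base_expansion_inj (N n : nat) (m m' : 'I_n -> nat) :
  (forall i, m i < N)%N -> (forall i, m' i < N)%N ->
  (\sum_(i < n) m i * N ^ i = \sum_(i < n) m' i * N ^ i)%N -> m =1 m'.
Proof.
elim: n m m' => [|n IHn] m m' lt_m lt_m'; first by move=> _ [].
rewrite !big_ord_recl /= !muln1.
have shift (f : 'I_n.+1 -> nat) : (\sum_(i < n) f (lift ord0 i) * N ^ bump 0 i =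
    (\sum_(i < n) f (lift ord0 i) * N ^ i) * N)%N.
  by rewrite big_distrl; apply: eq_bigr => i _; rewrite expnSr mulnA.
rewrite !shift => eq_sum.
have N_gt0 : (0 < N)%N by apply: leq_trans (lt_m ord0).
have eq0 : m ord0 = m' ord0.
  have := congr1 (modn^~ N) eq_sum.
  by rewrite !(addnC _ (_ * N)%N) !modnMDl !modn_small.
have eqS : (fun i => m (lift ord0 i)) =1 (fun i => m' (lift ord0 i)).
  apply: IHn => // ; move: eq_sum; rewrite eq0 => /addnI/eqP.
  by rewrite eqn_pmul2r // => /eqP.
by move=> i; case: (unliftP ord0 i) => [j ->|-> //]; apply: eqS.
Qed.

(* Kronecker substitution x_i := x ^ (N ^ i) *)
Lemma mpoly_nonroot (K : numFieldType) n (G : {mpoly K[n]}) :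
  G != 0 -> exists v, G.@[v] != 0.
Proof.
move=> nz_G; pose N := msize G; pose kr (mo : 'X_{1..n}) := (\sum_(i < n) mo i * N ^ i)%N.
have kr_inj : {in msupp G &, injective kr}.
  have lt_N mo : mo \in msupp G -> forall i, (mo i < N)%N.
    move=> /msize_mdeg_lt lt_mo i; apply: leq_ltn_trans lt_mo.
    by rewrite mdegE (bigD1 i) //= leq_addr.
  move=> mo mo' /lt_N lt_mo /lt_N lt_mo' /(base_expansion_inj lt_mo lt_mo') eq_mo.
  exact/mnmP.
pose p : {poly K} := \sum_(mo <- msupp G) G@_mo *: 'X^(kr mo).
have lead_G : mlead G \in msupp G by rewrite mlead_supp.
have nz_p : p != 0.
  apply: contraNneq nz_G => p0; rewrite -mleadc_eq0.
  have := congr1 (fun q : {poly K} => q`_(kr (mlead G))) p0.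
  rewrite coef_sum (bigD1_seq (mlead G)) ?msupp_uniq //= coefZ coefXn eqxx mulr1.
  rewrite big_seq_cond big1 ?addr0 ?coef0 => [->//|mo /andP[mo_G ne_mo]].
  rewrite coefZ coefXn (inj_in_eq kr_inj) // eq_sym (negPf ne_mo) mulr0 //.
have [x nz_px] : exists x, p.[x] != 0.
  (* The integers below [size p] are distinct in characteristic 0 and too many to be all roots. *)
  pose rs : seq K := [seq k%:R | k <- iota 0 (size p)].
  have uniq_rs : uniq rs by rewrite map_inj_uniq ?iota_uniq //; apply: mulrIn; apply: oner_neq0.
  have : ~~ all (root p) rs.
    apply/negP => all_rs; have := max_poly_roots nz_p all_rs uniq_rs.
    by rewrite size_map size_iota ltnn.
  by case/allPn => x _ nz_x; exists x.
exists (fun i => x ^+ (N ^ i)); apply: contraNneq nz_px => Gv0.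
rewrite -[X in _ == X]Gv0 mevalE /p horner_sum; apply/eqP; apply: eq_bigr => mo _.
rewrite hornerZ hornerXn /kr expr_sum; congr (_ * _).
by apply: eq_bigr => i _; rewrite -exprM mulnC.
Qed.

(** For density, a nonempty open V has some nonzero G among the equations of its complement; a point
    where neither G nor D vanishes lies in both sets. *)
Lemma for_general_nonvanishing (K : numFieldType) n e (D : {mpoly K[n * 3]})
    (P : ('I_n -> P2 K) -> Prop) :
  multihomog e D -> D != 0 ->
  (forall p M, homog_coords p M -> D.@[mxvec M 0] != 0 -> P p) ->
  for_general_points P.
Proof.
move=> homD nz_D imp_P.
exists [set p | exists M, homog_coords p M /\ D.@[mxvec M 0] != 0]; split.
- exists [set D]; split=> [G ->|]; first by exists e.
  apply/seteqP; split=> p /=.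
    move=> noM G M -> coords; apply/eqP; apply: contraT => nz; exfalso.
    by apply: noM; exists M.
  by move=> vanish [M [coords]]; rewrite (vanish D M) ?eqxx.
- move=> V [S [homS VE]] [p0 Vp0].
  have [G [SG nz_G]] : exists G, S G /\ G != 0.
    apply: contrapT => noG; have : (~` V) p0.
      rewrite VE => G M SG coords; have [->|nz_G] := eqVneq G 0; first by rewrite meval0.
      by exfalso; apply: noG; exists G.
    exact.
  (* The first coordinates are made nonzero too, so that every row of [M] defines a point. *)
  have nz_prod : \prod_(k < n) coord_var K k 0 != 0.
    by apply/prodf_neq0 => k _; rewrite -msupp_eq0 msuppX.
  have [v] := mpoly_nonroot (mulf_neq0 (mulf_neq0 nz_G nz_D) nz_prod).
  rewrite !mevalM rmorph_prod /= !mulf_eq0 !negb_or => /andP[/andP[Gv Dv] /prodf_neq0 Xv].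
  pose M : 'M[K]_(n, 3) := vec_mx (\row_j v j).
  have vE (Q : {mpoly K[n * 3]}) : Q.@[mxvec M 0] = Q.@[v].
    by apply: meval_eq => j; rewrite vec_mxK mxE.
  have nz_row k : row k M != 0.
    apply: contraNneq (Xv k isT) => /rowP/(_ 0).
    by rewrite /coord_var mevalXU !mxE => ->.
  have dim1 k : \dim <[row k M]>%VS == 1%N by rewrite dim_vline nz_row.
  pose p k : P2 K := exist _ <[row k M]>%VS (dim1 k).
  exists p; split; first by exists M; split=> //; rewrite vE.
  apply: contrapT => nVp; have : (~` V) p by [].
  by rewrite VE => /(_ G M SG (fun k => erefl)); rewrite vE => G0; rewrite G0 eqxx in Gv.
- by move=> p [M [coords nzM]]; apply: imp_P coords nzM.
Qed.

(** * Multiplicity in homogeneous coordinates *)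

Definition supp_rel n (R : nzRingType) (r : rel nat) (a : nat) (p : {mpoly R[n]}) : Prop :=
  forall mo, mo \in msupp p -> r a (mdeg mo).

Lemma supp_rel0 n (R : nzRingType) r a : supp_rel r a (0 : {mpoly R[n]}).
Proof. by move=> mo; rewrite msupp0. Qed.

Lemma supp_relD n (R : nzRingType) r a (p q : {mpoly R[n]}) :
  supp_rel r a p -> supp_rel r a q -> supp_rel r a (p + q).
Proof. by move=> rp rq mo /msuppD_le; rewrite mem_cat => /orP[/rp|/rq]. Qed.

Lemma supp_rel_sum n (R : nzRingType) r a (I : eqType) (s : seq I) (F : I -> {mpoly R[n]}) :
  (forall i, i \in s -> supp_rel r a (F i)) -> supp_rel r a (\sum_(i <- s) F i).
Proof.
move=> rF; rewrite big_seq_cond; elim/big_ind: _ => [||i /andP[/rF //]].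
- exact: supp_rel0.
- exact: supp_relD.
Qed.

Lemma supp_relZ n (R : nzRingType) r a c (p : {mpoly R[n]}) :
  supp_rel r a p -> supp_rel r a (c *: p).
Proof. by move=> rp mo /msuppZ_le/rp. Qed.

Lemma supp_relC n (R : nzRingType) (r : rel nat) a (c : R) : r a 0%N ->
  supp_rel r a (c%:MP : {mpoly R[n]}).
Proof.
move=> r0 mo; rewrite msuppC; case: eqP => // _; rewrite inE => /eqP ->.
by rewrite mdeg0.
Qed.

Lemma supp_relM n (R : nzRingType) (r : rel nat) a b (p q : {mpoly R[n]}) :
  (forall a a' b b', r a a' -> r b b' -> r (a + b) (a' + b'))%N ->
  supp_rel r a p -> supp_rel r b q -> supp_rel r (a + b)%N (p * q).
Proof.
move=> rD rp rq mo /msuppM_le/allpairsP[[m1 m2] /= [/rp r1 /rq r2 ->]].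
by rewrite mdegD; apply: rD.
Qed.

Lemma supp_relX n (R : nzRingType) (r : rel nat) a (p : {mpoly R[n]}) k :
  r 0%N 0%N -> (forall a a' b b', r a a' -> r b b' -> r (a + b) (a' + b'))%N ->
  supp_rel r a p -> supp_rel r (k * a)%N (p ^+ k).
Proof.
move=> r0 rD rp; elim: k => [|k IHk]; first by rewrite expr0 -mpolyC1; apply: supp_relC.
by rewrite exprS mulSn; apply: supp_relM.
Qed.

Lemma supp_rel_prod n (R : nzRingType) (r : rel nat) N (a : 'I_N -> nat)
    (F : 'I_N -> {mpoly R[n]}) :
  r 0%N 0%N -> (forall a a' b b', r a a' -> r b b' -> r (a + b) (a' + b'))%N ->
  (forall i, supp_rel r (a i) (F i)) -> supp_rel r (\sum_i a i)%N (\prod_i F i).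
Proof.
move=> r0 rD rF; elim/big_rec2: _ => [|i a' F' _ IH].
  by rewrite -mpolyC1; apply: supp_relC.
exact: supp_relM.
Qed.

Lemma expf_sub_div (F : fieldType) (x : F) (a b : nat) : x != 0 -> (b <= a)%N ->
  x ^+ (a - b) / x ^+ a = (x ^+ b)^-1.
Proof.
move=> nz_x le_ba; rewrite -[in X in _ / X](subnK le_ba) exprD invfM mulrA divff ?mul1r //.
by rewrite expf_neq0.
Qed.

(** With [leq], [supp_rel] bounds the order from below; with this relation it bounds the degree from
    above. *)
Definition geqn_rel : rel nat := fun a b => (b <= a)%N.

(* With X = c v + u, L = c + u_i and X - L v = dl, homogeneity turns the local
   equation H = \sum_al h_al 'X^al in the i-th chart at v into the identity
   F X = \sum_al h_al L^(d - |al|) dl^al, obtained in the fraction field. *)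
Lemma taylor_order (K : fieldType) d m (F : {mpoly K[3]}) (i : 'I_3)
    (v : 'rV[K]_3) (c : K) (u : 'I_3 -> {mpoly K[2]}) :
  F \is d.-homog -> v 0 i = 1 -> c != 0 -> (forall k, supp_rel leq 1 (u k)) ->
  (forall mo, (mdeg mo < m)%N -> (local_equation F i v)@_mo = 0) ->
  supp_rel leq m (F \mPo [tuple ((c *: v) 0 k)%:MP + u k | k < 3]).
Proof.
move=> homF v1 nz_c ord_u H0.
set H := local_equation F i v; set G := F \mPo _.
pose L : {mpoly K[2]} := c%:MP + u i.
pose dl k : {mpoly K[2]} := u k - v 0 k *: u i.
have nz_L : L != 0.
  apply: contraNneq nz_c => /(congr1 (mcoeff 0%MM)); rewrite mcoeffD mcoeffC eqxx mulr1 mcoeff0.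
  rewrite [X in _ + X]memN_msupp_eq0 ?addr0 => [->//|]; apply/negP => /ord_u.
  by rewrite mdeg0.
have XE k : ((c *: v) 0 k)%:MP + u k = v 0 k *: L + dl k.
  by rewrite mxE /L /dl scalerDr addrACA subrr addr0 -!mul_mpolyC mulrC mpolyCM.
pose f : K -> {fraction {mpoly K[2]}} := @tofrac _ \o @mpolyC 2 K.
pose h j : {fraction {mpoly K[2]}} := tofrac (dl (lift i j)) / tofrac L.
have nz_fL : tofrac L != 0 by rewrite tofrac_eq0.
have homS be : be \in msupp F -> (\sum_k be k)%N = d.
  by move=> be_F; rewrite -mdegE; apply: (dhomogP _ _ _ homF).
have psi_lq k : mmap f h (if unlift i k is Some j then 'X_j + (v 0 k)%:MP else 1) =
    tofrac (((c *: v) 0 k)%:MP + u k) / tofrac L.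
  rewrite XE; case: unliftP => [j ->|->].
    rewrite mmapD mmapX mmap1U mmapC /f /= -mul_mpolyC rmorphD rmorphM mulrDl.
    by rewrite mulfK // addrC.
  by rewrite v1 /dl v1 !scale1r subrr addr0 divff // -mpolyC1 mmapC /f /= mpolyC1 tofrac1.
(* H (dl / L) = F (v + dl / L) = F (L v + dl) / L^d by homogeneity. *)
have psiH : mmap f h H = tofrac G / tofrac L ^+ d.
  rewrite /H /G /local_equation !comp_mpolyE !raddf_sum mulr_suml.
  rewrite !big_seq; apply: eq_bigr => be be_F.
  rewrite /= mmapZ -mul_mpolyC [in RHS]rmorphM /= -mulrA; congr (_ * _).
  rewrite !rmorph_prod /= -(homS be be_F) expr_sum -prodf_div.
  apply: eq_bigr => k _; rewrite !rmorphXn /= -expr_div_n !tnth_mktuple.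
  by rewrite psi_lq.
(* This degree bound makes L^(d - |al|) a polynomial. *)
have degH al : al \in msupp H -> (\sum_j al j <= d)%N.
  rewrite -mdegE; move: al; rewrite -/(supp_rel geqn_rel d H).
  rewrite /H /local_equation comp_mpolyE; apply: supp_rel_sum => be be_F.
  apply: supp_relZ; rewrite -(homS be be_F).
  apply: supp_rel_prod => // [*|k]; first exact: leq_add.
  rewrite tnth_mktuple -[X in supp_rel _ X]muln1.
  apply: supp_relX => // [*|]; first exact: leq_add.
  case: unlift => [j|]; last by rewrite -mpolyC1; apply: supp_relC.
  apply: supp_relD; last exact: supp_relC.
  by move=> mo; rewrite msuppX inE => /eqP ->; rewrite mdeg1.
have GE : G = \sum_(al <- msupp H)
    H@_al *: (L ^+ (d - \sum_j al j) * \prod_j dl (lift i j) ^+ al j).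
  apply/eqP; rewrite -tofrac_eq; apply/eqP.
  apply: (mulIf (expf_neq0 d (invr_neq0 nz_fL))); rewrite exprVn -psiH /mmap raddf_sum mulr_suml.
  rewrite !big_seq; apply: eq_bigr => al al_H.
  rewrite -mul_mpolyC /= !rmorphM /= -!mulrA; congr (_ * _).
  have Ld := expf_sub_div nz_fL (degH al al_H).
  rewrite rmorphXn rmorph_prod /mmap1 /= mulrCA Ld.
  rewrite expr_sum -prodf_div; apply: eq_bigr => j _.
  by rewrite rmorphXn /= -expr_div_n.
rewrite GE; apply: supp_rel_sum => al al_H; apply: supp_relZ.
have le_m : (m <= \sum_j al j)%N.
  rewrite leqNgt -mdegE; apply/negP => /H0 /eqP; rewrite mcoeff_eq0.
  by rewrite al_H.
have leqD a a' b b' : (a <= a' -> b <= b' -> a + b <= a' + b')%N by move=> *; apply: leq_add.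
have rP : supp_rel leq (\sum_j al j)%N (\prod_j dl (lift i j) ^+ al j).
  apply: supp_rel_prod => // j; rewrite -[X in supp_rel _ X]muln1.
  apply: supp_relX => //; apply: supp_relD => //.
  by rewrite -scaleNr; apply: supp_relZ.
have rL : supp_rel leq 0%N (L ^+ (d - \sum_j al j)) by [].
by move=> mo /(supp_relM leqD rL rP); apply: leq_trans.
Qed.

(** A displacement of the first two homogeneous coordinates. It is used at every point, whichever
    chart contains it, as [taylor_order] allows any displacement of order at least 1. *)
Definition chart_var (K : nzRingType) (k : 'I_3) : {mpoly K[2]} :=
  [:: 'X_0; 'X_1; 0]`_k.

Lemma chart_var_order (K : nzRingType) k : supp_rel leq 1 (@chart_var K k).
Proof.
by case: k => [[|[|[|//]]] ?]; rewrite /chart_var /= => mo;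
   rewrite ?msupp0 // msuppX inE => /eqP ->; rewrite mdeg1.
Qed.

Lemma mul2_natr (R : comNzRingType) (x y z t s : R) (p q : nat) :
  x * y *+ p * (z * t *+ q) * s = (p * q)%:R * (x * z * s) * (y * t).
Proof. by rewrite natrM -[_ *+ p]mulr_natl -[_ *+ q]mulr_natl; ring. Qed.

Lemma mpolyCX n (R : comNzRingType) (c : R) k : (c ^+ k)%:MP_[n] = c%:MP ^+ k.
Proof. exact: rmorphXn. Qed.

Lemma mpolyC_natr n (R : comNzRingType) k : (k%:R : R)%:MP_[n] = k%:R.
Proof. exact: rmorph_nat. Qed.

Lemma coef_taylor_monomial (K : comNzRingType) (w : 'I_3 -> K) (be : 'I_3 -> nat)
    (mo : 'X_{1..2}) :
  (\prod_k ((w k)%:MP + chart_var K k) ^+ be k)@_mo =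
  ('C(be 0, mo 0) * 'C(be 1, mo 1))%:R *
  (w 0 ^+ (be 0 - mo 0) * w 1 ^+ (be 1 - mo 1) * w 2%:R ^+ be 2%:R).
Proof.
(* Large enough for both binomial sums to contain the indices given by [mo]. *)
pose N := (be 0%R + be 1%R + mo 0%R + mo 1%R).+1.
rewrite !big_ord_recl big_ord0 mulr1.
have -> : lift ord0 ord0 = 1 :> 'I_3 by apply: val_inj.
have -> : lift ord0 (lift ord0 ord0) = 2%:R :> 'I_3 by apply: val_inj.
have -> : ord0 = 0 :> 'I_3 by apply: val_inj.
rewrite [chart_var K 0](_ : _ = 'X_0) // [chart_var K 1](_ : _ = 'X_1) //.
rewrite [chart_var K 2%:R](_ : _ = 0) // addr0.
have lt0 : (be 0%R < N)%N by rewrite /N; lia.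
have lt1 : (be 1%R < N)%N by rewrite /N; lia.
have lt0' : (mo 0%R < N)%N by rewrite /N; lia.
have lt1' : (mo 1%R < N)%N by rewrite /N; lia.
rewrite (exprDn_wide _ _ lt0) (exprDn_wide _ _ lt1) mulrA.
have termE (a b : 'I_N) :
  ((((w 0)%:MP ^+ (be 0 - a) * 'X_0 ^+ a) *+ 'C(be 0, a)) *
   (((w 1)%:MP ^+ (be 1 - b) * 'X_1 ^+ b) *+ 'C(be 1, b)) * (w 2%:R)%:MP ^+ be 2%:R
     : {mpoly K[2]})@_mo =
  ('C(be 0, a) * 'C(be 1, b))%:R *
  (w 0 ^+ (be 0 - a) * w 1 ^+ (be 1 - b) * w 2%:R ^+ be 2%:R) *
  ((mo 0 == a) && (mo 1 == b))%:R.
  pose mab : 'X_{1..2} := (U_(0%R) *+ a + U_(1%R) *+ b)%MM.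
  have -> : (mo 0 == a) && (mo 1 == b) = (mab == mo).
    apply/andP/eqP => [[/eqP mo0 /eqP mo1]|<-]; last first.
      by rewrite !mnmDE !mulmnE !mnm1E /= !mul1n !mul0n addn0 add0n !eqxx.
    apply/mnmP => k; rewrite mnmDE !mulmnE !mnm1E.
    case: k => [[|[|//]] lt_k] /=; rewrite ?mul1n ?mul0n ?addn0 ?add0n -?mo0 -?mo1.
      by congr (mo _); apply: val_inj.
    by congr (mo _); apply: val_inj.
  rewrite -(mcoeffX K) -mcoeffCM mul2_natr /mab mpolyXD -!mpolyXn.
  by rewrite !mpolyCM !mpolyCX mpolyC_natr.
transitivity (\sum_(a < N) \sum_(b < N) ('C(be 0, a) * 'C(be 1, b))%:R *
  (w 0 ^+ (be 0 - a) * w 1 ^+ (be 1 - b) * w 2%:R ^+ be 2%:R) *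
  ((mo 0 == a) && (mo 1 == b))%:R).
  rewrite big_distrlr /= mulr_suml raddf_sum; apply: eq_bigr => a _.
  by rewrite /= mulr_suml raddf_sum; apply: eq_bigr => b _; rewrite /= termE.
rewrite (bigD1 (Ordinal lt0')) //= (bigD1 (Ordinal lt1')) //= !eqxx mulr1.
rewrite !big1 ?addr0 // => [a ne_a|b ne_b].
  by rewrite big1 // => b _; rewrite eq_sym (negPf ne_a : (a : nat) == mo 0 = false) mulr0.
by rewrite [_ == b :> nat]eq_sym (negPf ne_b : (b : nat) == mo 1 = false) mulr0.
Qed.

Definition mon3 d (t : exponents d) : 'X_{1..3} :=
  [multinom nth 0%N [:: nat_of_ord t.1; nat_of_ord t.2; (d - t.1 - t.2)%N] k | k < 3].

Lemma mdeg_mon3 d (t : exponents d) : (t.1 + t.2 <= d)%N -> mdeg (mon3 t) = d.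
Proof.
by move=> le_t; rewrite mdegE !big_ord_recl big_ord0 !mnmE /= addn0 -subnDA addnA subnKC.
Qed.

Lemma dhomog_expand (K : fieldType) d (F : {mpoly K[3]}) : F \is d.-homog for mdeg ->
  F = \sum_(t : exponents d | (t.1 + t.2 <= d)%N) F@_(mon3 t) *: 'X_[mon3 t].
Proof.
move=> homF; apply/mpolyP => mo; rewrite raddf_sum /=.
under eq_bigr do rewrite mcoeffZ mcoeffX.
have [deg_mo|ne_mo] := eqVneq (mdeg mo) d; last first.
  rewrite (dhomog_nemf_coeff homF ne_mo) big1 // => t le_t.
  case: eqP => [mo_t|]; last by rewrite mulr0.
  by rewrite -mo_t mdeg_mon3 ?eqxx in ne_mo.
have moE : (mo ord0 + (mo (lift ord0 ord0) + mo (lift ord0 (lift ord0 ord0))) = d)%N.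
  by rewrite -deg_mo mdegE !big_ord_recl big_ord0 addn0.
pose t0 : exponents d := (inord (mo ord0), inord (mo (lift ord0 ord0))).
have t01 : t0.1 = mo ord0 :> nat by rewrite inordK //; lia.
have t02 : t0.2 = mo (lift ord0 ord0) :> nat by rewrite inordK //; lia.
have t0E : mon3 t0 = mo.
  apply/mnmP => k; rewrite mnmE t01 t02.
  case: k => [[|[|[|//]]] lt_k] /=; last rewrite (_ : _ - _ - _ = mo (lift ord0 (lift ord0 ord0)))%N.
  - by congr (mo _); apply: val_inj.
  - by congr (mo _); apply: val_inj.
  - by congr (mo _); apply: val_inj.
  - by lia.
rewrite (bigD1 t0) /=; last by rewrite t01 t02; lia.
rewrite t0E eqxx mulr1 big1 ?addr0 // => t /andP[_ ne_t].
case: eqP => [mo_t|]; last by rewrite mulr0.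
case/eqP: ne_t; move: mo_t; rewrite -t0E => /mnmP eq_t.
have := eq_t ord0; have := eq_t (lift ord0 ord0); rewrite !mnmE /= => eq2 eq1.
by case: t {eq_t} eq1 eq2 => t1 t2 /= eq1 eq2; congr (_, _); apply: val_inj.
Qed.

Lemma cond_entry_sum (K : fieldType) n d m (w : 'I_n -> 'I_3 -> K) (k : 'I_n) (a b : 'I_m)
    (F : {mpoly K[3]}) : F \is d.-homog for mdeg -> (a + b < m)%N ->
  \sum_(t : exponents d) cond_entry w (inl (k, a, b)) t *
    (if (t.1 + t.2 <= d)%N then F@_(mon3 t) else 0) =
  (F \mPo [tuple (w k j)%:MP + chart_var K j | j < 3])@_(U_(0%R) *+ a + U_(1%R) *+ b)%MM.
Proof.
move=> homF lt_m; rewrite [in RHS](dhomog_expand homF).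
rewrite (raddf_sum (comp_mpoly _)) (raddf_sum (mcoeff _)) /= [RHS]big_mkcond.
apply: eq_bigr => t _; rewrite lt_m /=; case: ifP => _; last by rewrite mulr0.
rewrite comp_mpolyZ mcoeffZ comp_mpolyX mulrC; congr (_ * _).
under eq_bigr do rewrite tnth_mktuple.
rewrite coef_taylor_monomial !mnmDE !mulmnE !mnm1E /= !mul1n !mul0n addn0 add0n.
by rewrite !mnmE.
Qed.

Lemma linear_system_empty (K : fieldType) n d m (p : 'I_n.+1 -> P2 K) (M : 'M[K]_(n.+1, 3)) :
  homog_coords p M -> kernel_trivial d m (fun k i => M k i) ->
  linear_system d (fun _ => m) p = set0.
Proof.
move=> coords ker0; apply/seteqP; split=> // C LC.
have [F0 [_ [_ [F0C _ _ _]]]] := LC ord0.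
have nz_F0 : val F0 != 0.
  have := svalP C; rewrite -F0C dim_vline eqb1; apply: contraNneq => F00.
  by apply/eqP; apply: val_inj.
have homF0 : val F0 \is d.-homog for mdeg := dhomog_is_dhomog F0.
pose c (t : exponents d) := if (t.1 + t.2 <= d)%N then (val F0)@_(mon3 t) else 0.
have c0 : forall t, c t = 0.
  apply: ker0 => -[[[k a] b]|s] /=; last first.
    case: (ltnP d (s.1 + s.2)) => [lt_s|_]; last by rewrite big1 // => t _; rewrite mul0r.
    rewrite (bigD1 s) //= eqxx mul1r /c leqNgt lt_s add0r big1 // => t ne_t.
    by rewrite eq_sym (negPf ne_t) mul0r.
  have [lt_m|ge_m] := ltnP (a + b) m; last first.
    by rewrite big1 // => t _; rewrite mul0r.
  have [F [v [i [FC vp v1 H0]]]] := LC k.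
  (* The form and the vector provided at the k-th point are only proportional to [F0] and to the
     k-th row of [M]. *)
  have /vlineP[x F0E] : F0 \in <[F]>%VS by rewrite FC -F0C memv_line.
  have /vlineP[y ME] : row k M \in <[v]>%VS by rewrite vp -coords memv_line.
  have nz_y : y != 0.
    have := svalP (p k); rewrite -coords dim_vline; apply: contraTneq => y0.
    by rewrite ME y0 scale0r eqxx.
  have ordF := taylor_order (dhomog_is_dhomog F) v1 nz_y (@chart_var_order K) H0.
  have := @cond_entry_sum K n.+1 d m (fun k i => M k i) k a b _ homF0 lt_m.
  rewrite /cond_entry lt_m => ->.
  rewrite F0E /= comp_mpolyZ mcoeffZ.
  rewrite (_ : [tuple (M k j)%:MP + chart_var K j | j < 3] =
      [tuple ((y *: v) 0 j)%:MP + chart_var K j | j < 3]); last first.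
    by apply: eq_mktuple => j; rewrite -ME mxE.
  rewrite [X in _ * X]memN_msupp_eq0 ?mulr0 //; apply/negP => /ordF.
  by rewrite mdegD !mdegMn !mdeg1 !mul1n leqNgt lt_m.
case/eqP: nz_F0; rewrite (dhomog_expand homF0) big1 // => t le_t.
by have := c0 t; rewrite /c le_t => ->; rewrite scale0r.
Qed.

Theorem mainTheorem2 (R : realType) :
  for_general_points (fun p : 'I_10 -> P2 R[i] =>
    linear_system 174 (fun _ : 'I_10 => 55%N) p = set0).
Proof.
have [g nz_g] := curve_points_minor R[i].
pose M : 'M[R[i]]_(10, 3) := \matrix_(k, j) curve_points R[i] k j.
apply: (@for_general_nonvanishing R[i] 10 _ _ _ (@det_cond_minor_multihomog R[i] 10 174 55 g)).
  (* The minor is a nonzero polynomial because its value at the special points is nonzero. *)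
  apply: contraNneq nz_g => D0.
  have := meval_det_cond_minor g M; rewrite D0 meval0 => /esym/eqP.
  by rewrite (@eq_cond_minor _ _ _ _ _ (@curve_points R[i] 10)) // => k j; rewrite mxE.
move=> p N coords; rewrite meval_det_cond_minor => nz_N.
exact: linear_system_empty coords (cond_minor_kernel_trivial nz_N).
Qed.
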